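(* A finite simple graph is $\{P_5,\overline{P_5}\}$-free if and only if it is obtained from pentagons and split graphs by repeated substitutions, split unifications, and split unifications in the complement; that is, if and only if it belongs to the smallest class of graphs that contains all graphs isomorphic to $C_5$ and all split graphs and is closed under substitution (substituting a graph of the class for a vertex of a graph of the class), under taking the split unification of a composable pair of graphs of the class, and under taking a graph whose complement is the split unification of a composable pair $(G_1,G_2)$ with $\overline{G_1},\overline{G_2}$ in the class.
   Context: $P_5$ is the path on 5 vertices, $C_5$ (pentagon) the 5-cycle, $\overline{G}$ the complement of $G$. A graph is $\{P_5,\overline{P_5}\}$-free if it has no induced subgraph isomorphic to $P_5$ or $\overline{P_5}$. A graph is split if its vertex set can be partitioned into a clique and a stable set. Substitution: given vertex-disjoint graphs $G_0$ and $H$ and a vertex $x$ of $G_0$, the graph obtained by substituting $H$ for $x$ has vertex set $V(G_0\setminus x)\cup V(H)$, consists of the union of $G_0\setminus x$ and $H$, plus all edges between $V(H)$ and the neighbors of $x$ in $G_0$. For $S\subseteq V(G)$ and $v\notin S$: $v$ is complete to $S$ if adjacent to all of $S$, anticomplete if adjacent to none, mixed on $S$ otherwise; a set is complete (anticomplete) to a disjoint set if each of its vertices is. An anticomponent of $S$ is a subset of $S$ inducing a connected component of the complement of $G[S]$. Composable pair: let $A,B,C,L,T$ be pairwise disjoint sets with $A,C$ non-empty, and $a^*,c^*$ two distinct vertices not in $A\cup B\cup C\cup L\cup T$. $G_1$ is a graph on $A\cup B\cup L\cup T\cup\{c^*\}$ such that $L$ is a (possibly empty) clique, $T$ is a (possibly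 empty) stable set, $A$ is complete to $B$ and anticomplete to $T$, some vertex of $A$ is complete to $L$, and $c^*$ is complete to $B\cup L$ and anticomplete to $A\cup T$ (other adjacencies arbitrary). $G_2$ is a graph on $B\cup C\cup L\cup T\cup\{a^*\}$ such that $G_2[B\cup L\cup T]=G_1[B\cup L\cup T]$, $T$ is anticomplete to $C$, $L$ is complete to $B\cup C$, $a^*$ is complete to $B\cup L$ and anticomplete to $C\cup T$, some vertex of $C$ is complete to $B$, and no vertex of $C$ is mixed on any anticomponent of $B$ (other adjacencies arbitrary). Its split unification is the graph on $A\cup B\cup C\cup L\cup T$ whose restriction to $A\cup B\cup L\cup T$ is $G_1\setminus c^*$, whose restriction to $B\cup C\cup L\cup T$ is $G_2\setminus a^*$, and in which $A$ is anticomplete to $C$. *)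

(* Defs.v *)
From mathcomp Require Import all_boot.

Set Implicit Arguments.
Unset Strict Implicit.
Unset Printing Implicit Defensive.

Record sgraph (V : finType) := SGraph {
  adj :> rel V;
  adj_sym : symmetric adj;
  adj_irr : irreflexive adj }.

Definition isomorphic (V W : finType) (G : sgraph V) (H : sgraph W) : Prop :=
  exists2 f : V -> W, bijective f & {mono f : x y / G x y >-> H x y}.

Section Basic.
Variables (V : finType) (G : sgraph V).

Definition compl_rel : rel V := fun x y => (x != y) && ~~ G x y.

Lemma compl_sym : symmetric compl_rel.
Proof. by move=> x y; rewrite /compl_rel eq_sym adj_sym. Qed.

Lemma compl_irr : irreflexive compl_rel.
Proof. by move=> x; rewrite /compl_rel eqxx. Qed.

Definition compl : sgraph V := SGraph compl_sym compl_irr.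

Section Induced.
Variable S : {set V}.

Definition induced_rel : rel {x | x \in S} := fun x y => G (val x) (val y).

Lemma induced_sym : symmetric induced_rel.
Proof. by move=> x y; rewrite /induced_rel adj_sym. Qed.

Lemma induced_irr : irreflexive induced_rel.
Proof. by move=> x; rewrite /induced_rel adj_irr. Qed.

Definition induced : sgraph {x | x \in S} := SGraph induced_sym induced_irr.
End Induced.

Definition clique (K : {set V}) : Prop :=
  {in K &, forall x y, x != y -> G x y}.

Definition stable (S : {set V}) : Prop :=
  {in S &, forall x y, ~~ G x y}.

Definition split_graph : Prop :=
  exists K S : {set V},
    [/\ K :|: S = [set: V], [disjoint K & S], clique K & stable S].

Definition vcomplete (x : V) (S : {set V}) : Prop := {in S, forall y, G x y}.

Definition vanticomplete (x : V) (S : {set V}) : Prop :=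
  {in S, forall y, ~~ G x y}.

Definition mixed (x : V) (S : {set V}) : Prop :=
  ~ vcomplete x S /\ ~ vanticomplete x S.

Definition complete (X Y : {set V}) : Prop := {in X, forall x, vcomplete x Y}.

Definition anticomplete (X Y : {set V}) : Prop :=
  {in X, forall x, vanticomplete x Y}.

(* [anti_rel S] is the adjacency of the complement of G[S], seen on V. *)
Definition anti_rel (S : {set V}) : rel V :=
  fun x y => [&& x \in S, y \in S & compl x y].

Definition anticomponent (S X : {set V}) : Prop :=
  exists2 x, x \in S & X = [set y in S | connect (anti_rel S) x y].
End Basic.

Definition contains_induced (V W : finType) (G : sgraph V) (H : sgraph W)
    : Prop :=
  exists S : {set V}, isomorphic (induced G S) H.

Definition P5_rel : rel 'I_5 := fun i j => (i.+1 == j) || (j.+1 == i).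

Lemma P5_sym : symmetric P5_rel.
Proof. by move=> i j; rewrite /P5_rel orbC. Qed.

Lemma P5_irr : irreflexive P5_rel.
Proof. by move=> i; rewrite /P5_rel orbb -[X in _ == X]addn0 -addn1 eqn_add2l. Qed.

Definition P5 : sgraph 'I_5 := SGraph P5_sym P5_irr.

Definition C5_rel : rel 'I_5 :=
  fun i j => (i.+1 %% 5 == j) || (j.+1 %% 5 == i).

Lemma C5_sym : symmetric C5_rel.
Proof. by move=> i j; rewrite /C5_rel orbC. Qed.

Lemma C5_irr : irreflexive C5_rel.
Proof. by case=> [[|[|[|[|[|]]]]]]. Qed.

Definition C5 : sgraph 'I_5 := SGraph C5_sym C5_irr.

Definition P5_antiP5_free (V : finType) (G : sgraph V) : Prop :=
  ~ contains_induced G P5 /\ ~ contains_induced G (compl P5).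

Section Substitution.
Variables (V W : finType) (G0 : sgraph V) (x : V) (H : sgraph W).

Definition subst_rel : rel ({v : V | v != x} + W)%type := fun p q =>
  match p, q with
  | inl u, inl v => G0 (val u) (val v)
  | inl u, inr _ => G0 (val u) x
  | inr _, inl v => G0 x (val v)
  | inr s, inr t => H s t
  end.

Lemma subst_sym : symmetric subst_rel.
Proof. by move=> [u|s] [v|t]; rewrite /= adj_sym. Qed.

Lemma subst_irr : irreflexive subst_rel.
Proof. by move=> [u|s]; rewrite /= adj_irr. Qed.

Definition substitution : sgraph ({v : V | v != x} + W)%type :=
  SGraph subst_sym subst_irr.
End Substitution.

(* The sets A, B, C, L, T and the vertices a*, c* live in an ambient type U.
   A graph whose vertex set is a subset S of U is encoded as [induced G S] for
   some graph G on U: the graphs of the pair are [induced G1 (A ∪ B ∪ L ∪ T ∪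
   {c*})] and [induced G2 (B ∪ C ∪ L ∪ T ∪ {a*})], and the adjacencies of G1
   and G2 outside these sets are irrelevant. *)
Section SplitUnification.
Variables (U : finType) (G1 G2 : sgraph U) (A B C L T : {set U}) (a c : U).

Record composable : Prop := Composable {
  comp_disj : pairwise (fun X Y : {set U} => [disjoint X & Y])
                [:: A; B; C; L; T];
  comp_A : A != set0;
  comp_C : C != set0;
  comp_ac : a != c;
  comp_a : a \notin A :|: B :|: C :|: L :|: T;
  comp_c : c \notin A :|: B :|: C :|: L :|: T;
  comp1_L : clique G1 L;
  comp1_T : stable G1 T;
  comp1_AB : complete G1 A B;
  comp1_AT : anticomplete G1 A T;
  comp1_AL : exists2 x, x \in A & vcomplete G1 x L;
  comp1_c : vcomplete G1 c (B :|: L);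
  comp1_cN : vanticomplete G1 c (A :|: T);
  comp12 : {in B :|: L :|: T &, G2 =2 G1};
  comp2_TC : anticomplete G2 T C;
  comp2_L : complete G2 L (B :|: C);
  comp2_a : vcomplete G2 a (B :|: L);
  comp2_aN : vanticomplete G2 a (C :|: T);
  comp2_CB : exists2 x, x \in C & vcomplete G2 x B;
  comp2_mixed : forall x X, x \in C -> anticomponent G2 B X -> ~ mixed G2 x X }.

Definition part1 : sgraph {x | x \in A :|: B :|: L :|: T :|: [set c]} :=
  induced G1 (A :|: B :|: L :|: T :|: [set c]).

Definition part2 : sgraph {x | x \in B :|: C :|: L :|: T :|: [set a]} :=
  induced G2 (B :|: C :|: L :|: T :|: [set a]).

(* No pair in A x C is contained in either of the two sets below, so A is
   anticomplete to C; on B ∪ L ∪ T the two clauses agree by [comp12]. *)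
Definition unif_rel : rel U := fun x y =>
     [&& x \in A :|: B :|: L :|: T, y \in A :|: B :|: L :|: T & G1 x y]
  || [&& x \in B :|: C :|: L :|: T, y \in B :|: C :|: L :|: T & G2 x y].

Lemma unif_sym : symmetric unif_rel.
Proof.
by move=> x y; rewrite /unif_rel (adj_sym G1) (adj_sym G2); congr (_ || _);
  rewrite andbCA.
Qed.

Lemma unif_irr : irreflexive unif_rel.
Proof. by move=> x; rewrite /unif_rel !adj_irr !andbF. Qed.

Definition split_unification :
    sgraph {x | x \in A :|: B :|: C :|: L :|: T} :=
  induced (SGraph unif_sym unif_irr) (A :|: B :|: C :|: L :|: T).
End SplitUnification.

(* Each operation is closed up to isomorphism, which accounts for the free
   choice of vertex names. *)
Inductive generated : forall V : finType, sgraph V -> Prop :=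
| gen_pentagon (V : finType) (G : sgraph V) :
    isomorphic G C5 -> generated G
| gen_split (V : finType) (G : sgraph V) :
    split_graph G -> generated G
| gen_subst (V V0 W : finType) (G : sgraph V) (G0 : sgraph V0) (x : V0)
    (H : sgraph W) :
    generated G0 -> generated H ->
    isomorphic G (substitution G0 x H) -> generated G
| gen_unif (V U : finType) (G : sgraph V) (G1 G2 : sgraph U)
    (A B C L T : {set U}) (a c : U) :
    composable G1 G2 A B C L T a c ->
    generated (part1 G1 A B L T c) -> generated (part2 G2 B C L T a) ->
    isomorphic G (split_unification G1 G2 A B C L T) -> generated G
| gen_counif (V U : finType) (G : sgraph V) (G1 G2 : sgraph U)
    (A B C L T : {set U}) (a c : U) :
    composable G1 G2 A B C L T a c ->
    generated (compl (part1 G1 A B L T c)) ->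
    generated (compl (part2 G2 B C L T a)) ->
    isomorphic (compl G) (split_unification G1 G2 A B C L T) -> generated G.

(* Main.v *)
Require Import Defs.
From mathcomp Require Import all_boot.

(** P5 and its complement are prime, so an induced copy in a substitution lives in
    one of the two factors.  In a split unification, a copy in which A is complete
    to L (or C is complete to B) moves into one of the two parts by collapsing A to
    a* or C to c*.  Otherwise the copy contains an induced path a - b - l - c with
    a, b, l, c in A, B, L, C, and no fifth vertex is attached to this path in a way
    compatible with P5 or its complement.

    Conversely, argue by induction on the number of vertices.  If the graph contains
    a pentagon, it is a pentagon or the clones of the pentagon's vertices yield a
    homogeneous set.  If it contains no pentagon, then either it is split or two
    disjoint anticomplete edges occur in it or in its complement; complementing,
    we may assume the former.  Take a minimal set S whose removal leaves two
    nontrivial components.  Each vertex of S has a neighbour in every nontrivial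
    component and is mixed on at most one of them, so for a nontrivial component D
    the set L of vertices of S mixed on D yields a split divide as soon as L is a
    clique.  If this fails for two components, a nonadjacent pair in one of the two
    sets L is an edge of the complement, anticomplete there to a connected set
    containing the other component.  The same construction in the complement then
    produces an L contained in the trivial components of G - S, hence stable in G. *)

Set Implicit Arguments.
Unset Strict Implicit.
Unset Printing Implicit Defensive.

Ltac adj_done := first [done | by rewrite adj_sym].

(** * Full homomorphisms *)

(* Not necessarily injective: vertices with the same neighbourhood may be
   identified, so duplicating vertices creates no new twin-free pattern. *)
Definition full_hom (W V : finType) (K : sgraph W) (G : sgraph V) : Prop :=
  exists f : W -> V, {mono f : i j / K i j >-> G i j}.

Lemma full_hom_trans (V1 V2 V3 : finType) (G1 : sgraph V1) (G2 : sgraph V2)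
    (G3 : sgraph V3) : full_hom G1 G2 -> full_hom G2 G3 -> full_hom G1 G3.
Proof. by move=> [f fM] [g gM]; exists (g \o f) => i j /=; rewrite gM fM. Qed.

Lemma isomorphic_sym (V W : finType) (G : sgraph V) (H : sgraph W) :
  isomorphic G H -> isomorphic H G.
Proof.
case=> f [g fK gK] fM; exists g; first by exists f.
by move=> x y; rewrite -fM !gK.
Qed.

Lemma isomorphic_full_hom (V W : finType) (G : sgraph V) (H : sgraph W) :
  isomorphic G H -> full_hom G H.
Proof. by case=> f _ fM; exists f. Qed.

Lemma induced_full_hom (V : finType) (G : sgraph V) (S : {set V}) :
  full_hom (induced G S) G.
Proof. by exists val. Qed.

Lemma full_hom_induced (W V : finType) (K : sgraph W) (G : sgraph V)
    (S : {set V}) (f : W -> V) :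
  (forall i, f i \in S) -> {mono f : i j / K i j >-> G i j} ->
  full_hom K (induced G S).
Proof. by move=> fS fM; exists (fun i => exist _ (f i) (fS i)) => i j; apply: fM. Qed.

Definition twin_free (W : finType) (K : sgraph W) : Prop :=
  forall i j, K i =1 K j -> i = j.

Lemma twin_free_inj (W V : finType) (K : sgraph W) (G : sgraph V) (f : W -> V) :
  twin_free K -> {mono f : i j / K i j >-> G i j} -> injective f.
Proof. by move=> tK fM i j fij; apply: tK => k; rewrite -!fM fij. Qed.

Lemma contains_inducedP (W V : finType) (K : sgraph W) (G : sgraph V) :
  twin_free K -> contains_induced G K <-> full_hom K G.
Proof.
move=> tK; split=> [[S /isomorphic_sym/isomorphic_full_hom KS]|[f fM]].
  exact: full_hom_trans KS (induced_full_hom _ _).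
have fI := twin_free_inj tK fM.
exists (f @: W); apply: isomorphic_sym.
exists (fun i => exist _ (f i) (imset_f f (isT : i \in W))); last exact: fM.
apply: inj_card_bij; last by rewrite card_sig card_imset.
by move=> i j /(congr1 val) /= /fI.
Qed.

Section Complement.
Variables (V : finType) (G : sgraph V).

Lemma complK : compl (compl G) =2 G.
Proof.
move=> x y; rewrite /= /compl_rel /= /compl_rel.
by case: eqP => [->|_] /=; rewrite ?adj_irr ?negbK.
Qed.

Lemma full_hom_complK : full_hom G (compl (compl G)).
Proof. by exists id => x y; apply: complK. Qed.

Lemma compl_neq x y : x != y -> compl G x y = ~~ G x y.
Proof. by rewrite /= /compl_rel => ->. Qed.

Lemma compl_nadj x y : compl G x y -> ~~ G x y.
Proof. by case/andP. Qed.

Lemma nadj_compl x y : G x y -> ~~ compl G x y.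
Proof. by rewrite /= /compl_rel negb_and negbK orbC => ->. Qed.

Lemma full_hom_compl_right (W : finType) (K : sgraph W) :
  twin_free K -> full_hom K (compl G) -> full_hom (compl K) G.
Proof.
move=> tK [f fM]; exists f => i j; have fI := twin_free_inj tK fM.
by rewrite -[LHS]complK /= /compl_rel fM (inj_eq fI).
Qed.

End Complement.

Lemma full_hom_compl_left (W V : finType) (K : sgraph W) (G : sgraph V) :
  twin_free (compl K) -> full_hom (compl K) G -> full_hom K (compl G).
Proof.
move=> tK KG.
have KcG := full_hom_trans KG (full_hom_complK G).
exact: full_hom_trans (full_hom_complK K) (full_hom_compl_right tK KcG).
Qed.

Section Pullback.
Variables (W V : finType) (h : W -> V) (G : sgraph V).

Lemma pullback_sym : symmetric (relpre h G).
Proof. by move=> x y; apply: adj_sym. Qed.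

Lemma pullback_irr : irreflexive (relpre h G).
Proof. by move=> x; apply: adj_irr. Qed.

Definition pullback : sgraph W := SGraph pullback_sym pullback_irr.

Lemma pullback_full_hom : full_hom pullback G.
Proof. by exists h. Qed.

End Pullback.

(** * Homogeneous sets and prime graphs *)

Definition homogeneous (V : finType) (G : sgraph V) (M : {set V}) : Prop :=
  forall w x y, w \notin M -> x \in M -> y \in M -> G w x = G w y.

Definition prime_graph (W : finType) (K : sgraph W) : Prop :=
  forall M, homogeneous K M -> {in M &, forall i j, i = j} \/ M = setT.

Definition proper_homogeneous (V : finType) (G : sgraph V) (M : {set V}) : Prop :=
  [/\ homogeneous G M, 1 < #|M| & M != setT].

Lemma prime_compl (W : finType) (K : sgraph W) :
  prime_graph K -> prime_graph (compl K).
Proof.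
move=> pK M M_hom; apply: pK => w x y wM xM yM.
have /negb_inj : ~~ K w x = ~~ K w y; last by [].
rewrite -!compl_neq; first exact: M_hom.
  by apply: contraNneq wM => ->.
by apply: contraNneq wM => ->.
Qed.

Lemma prime_twin_free (W : finType) (K : sgraph W) :
  2 < #|W| -> prime_graph K -> twin_free K.
Proof.
move=> W2 pK i j Kij.
have [w x y _|ij_eq|ijT] := pK [set i; j].
- by rewrite !inE ![K w _]adj_sym => /orP[] /eqP-> /orP[] /eqP->; rewrite ?Kij.
- by apply: ij_eq; rewrite !inE eqxx ?orbT.
by move: W2; rewrite -cardsT -ijT cards2; case: (_ != _).
Qed.

(* The condition on [h] makes [M] homogeneous in [K]. *)
Lemma prime_collapse (W U : finType) (K : sgraph W) (G : sgraph U)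
    (M : {set W}) (h : W -> U) :
  prime_graph K -> {in M &, forall i j, h i = h j} ->
  (forall i j, i \notin M -> G (h i) (h j) = K i j) ->
  M = setT \/ {mono h : i j / K i j >-> G i j}.
Proof.
move=> pK h_const h_adj; have [w x y wM xM yM|M_single|] := pK M; last by left.
  by rewrite -!h_adj // (h_const x y).
right=> i j; have [iM|/h_adj //] := boolP (i \in M).
have [jM|jM] := boolP (j \in M); last by rewrite adj_sym h_adj // adj_sym.
by rewrite (M_single i j iM jM) !adj_irr.
Qed.

Lemma substitution_full_hom (W V0 V1 : finType) (K : sgraph W) (G : sgraph V0)
    (x : V0) (H : sgraph V1) :
  prime_graph K -> full_hom K (substitution G x H) ->
  full_hom K G \/ full_hom K H.
Proof.
move=> pK [f fM]; pose inH i := if f i is inr _ then true else false.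
pose h i := if f i is inl u then val u else x.
have [i j|i j|allH|h_mono] := @prime_collapse _ _ K G [set i | inH i] h pK.
- by rewrite !inE /inH /h; case: (f i) (f j) => [?|?] [?|?].
- by rewrite inE -fM /inH /h; case: (f i) (f j) => [?|?] [?|?].
- right; have /fin_all_exists [g gE] i : exists y, f i = inr y.
    by have := in_setT i; rewrite -allH inE /inH; case: (f i) => // y _; exists y.
  by exists g => i j; rewrite -fM !gE.
by left; exists h.
Qed.

(** * The five-vertex graphs *)

Notation ord5 k := (@Ordinal 5 k isT).

Definition ords5 : seq 'I_5 := [:: ord5 0; ord5 1; ord5 2; ord5 3; ord5 4].

Lemma mem_ords5 i : i \in ords5.
Proof. by case: i => [[|[|[|[|[|]]]]]]. Qed.

Lemma forall_ord5 (p : pred 'I_5) : [forall i, p i] = all p ords5.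
Proof.
by apply/forallP/allP => [p_all i _|p_all i]; [|apply/p_all/mem_ords5].
Qed.

Lemma exists_ord5 (p : pred 'I_5) : [exists i, p i] = has p ords5.
Proof.
apply/existsP/hasP => [[i pi]|[i _ pi]]; exists i => //; exact: mem_ords5.
Qed.

Lemma ord5_ind (P : 'I_5 -> Prop) :
  P (ord5 0) -> P (ord5 1) -> P (ord5 2) -> P (ord5 3) -> P (ord5 4) ->
  forall i, P i.
Proof.
move=> P0 P1 P2 P3 P4 i; have := mem_ords5 i; rewrite !inE.
by do 4 (case/predU1P=> [-> //|]); move/eqP->.
Qed.

Lemma prime_ord5 (K : sgraph 'I_5) :
  (forall m : pred 'I_5,
     [forall i, forall j, forall k,
        [&& m i, m j & ~~ m k] ==> (K k i == K k j)] ->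
     [forall i, forall j, m i && m j ==> (i == j)] || [forall i, m i]) ->
  prime_graph K.
Proof.
move=> primeK M M_hom; have /primeK : [forall i, forall j, forall k,
    [&& i \in M, j \in M & k \notin M] ==> (K k i == K k j)].
  apply/forallP => i; apply/forallP => j; apply/forallP => k.
  by apply/implyP => /and3P[iM jM kM]; rewrite (M_hom k i j).
case/orP => [/forallP M_single|/forallP MT].
  left=> i j iM jM; have /forallP/(_ j) := M_single i.
  by rewrite iM jM => /eqP.
by right; apply/setP => i; rewrite inE; apply: MT.
Qed.

Lemma prime_P5 : prime_graph P5.
Proof.
apply: prime_ord5 => m; do 3!rewrite !forall_ord5 /=.
by do 5!case: (m _).
Qed.

Lemma prime_C5 : prime_graph C5.
Proof.
apply: prime_ord5 => m; do 3!rewrite !forall_ord5 /=.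
by do 5!case: (m _).
Qed.

Lemma twin_free_P5 : twin_free P5.
Proof. by apply: prime_twin_free prime_P5; rewrite card_ord. Qed.

Lemma twin_free_compl_P5 : twin_free (compl P5).
Proof. by apply: prime_twin_free (prime_compl prime_P5); rewrite card_ord. Qed.

Lemma twin_free_C5 : twin_free C5.
Proof. by apply: prime_twin_free prime_C5; rewrite card_ord. Qed.

Lemma C5_self_complementary : isomorphic C5 (compl C5).
Proof.
pose double (i : 'I_5) := nth i [:: ord5 0; ord5 2; ord5 4; ord5 1; ord5 3] i.
exists double; last by apply: ord5_ind; apply: ord5_ind.
by apply: injF_bij; do 2![apply: ord5_ind].
Qed.

(* Deleting a vertex [n] of P5 or of its complement leaves a path
   [a - b - c - d] only if [n] is attached to it in one of these ways. *)
Definition extends_P4 (V : finType) (G : sgraph V) (a b c d n : V) : bool :=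
  [:: G n a; G n b; G n c; G n d] \in
    [:: [:: true; false; false; false]; [:: false; false; false; true];
        [:: true; true; false; true]; [:: true; false; true; true]].

Definition P4s_extend (V : finType) (G : sgraph V) : Prop :=
  forall a b c d, G a b -> G b c -> G c d -> ~~ G a c -> ~~ G a d -> ~~ G b d ->
  exists n, extends_P4 G a b c d n.

Lemma P4s_extend_P5 : P4s_extend P5.
Proof.
by do 4![apply: ord5_ind] => // *; apply/existsP; rewrite exists_ord5.
Qed.

Lemma P4s_extend_compl_P5 : P4s_extend (compl P5).
Proof.
by do 4![apply: ord5_ind] => // *; apply/existsP; rewrite exists_ord5.
Qed.

Lemma P5_antiP5_freeP (V : finType) (G : sgraph V) :
  P5_antiP5_free G <-> ~ full_hom P5 G /\ ~ full_hom (compl P5) G.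
Proof.
have P5P := contains_inducedP G twin_free_P5.
have antiP5P := contains_inducedP G twin_free_compl_P5.
by rewrite /P5_antiP5_free; tauto.
Qed.

Lemma P5_antiP5_free_full_hom (V W : finType) (H : sgraph W) (G : sgraph V) :
  full_hom H G -> P5_antiP5_free G -> P5_antiP5_free H.
Proof.
move=> HG /P5_antiP5_freeP[nP5 nantiP5]; apply/P5_antiP5_freeP.
by split=> [/full_hom_trans/(_ HG)|/full_hom_trans/(_ HG)].
Qed.

Lemma compl_P5_antiP5_free (V : finType) (G : sgraph V) :
  P5_antiP5_free (compl G) <-> P5_antiP5_free G.
Proof.
suff freeC (H : sgraph V) : P5_antiP5_free H -> P5_antiP5_free (compl H).
  split=> [/freeC|/freeC //].
  exact: P5_antiP5_free_full_hom (full_hom_complK G).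
move=> /P5_antiP5_freeP[nP5 nantiP5]; apply/P5_antiP5_freeP; split.
  by move=> /(full_hom_compl_right twin_free_P5).
move=> /(full_hom_compl_right twin_free_compl_P5).
by move=> /(full_hom_trans (full_hom_complK P5)).
Qed.

(** * Generated graphs are free *)

Lemma split_graph_compl (V : finType) (G : sgraph V) :
  split_graph G -> split_graph (compl G).
Proof.
case=> K [S [KS_cover KS_disj K_clique S_stable]].
exists S, K; split; rewrite 1?setUC 1?disjoint_sym //.
  by move=> x y xS yS xy; rewrite compl_neq // S_stable.
move=> x y xK yK; rewrite /= /compl_rel.
by have [//|xy] := eqVneq x y; rewrite negbK K_clique.
Qed.

(* The two end edges of P5 would each have a vertex in the clique. *)
Lemma split_graph_no_P5 (V : finType) (G : sgraph V) :
  split_graph G -> ~ full_hom P5 G.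
Proof.
case=> K [S [KS_cover _ K_clique S_stable]] [f fM].
have fI := twin_free_inj twin_free_P5 fM.
have notK_S x : x \notin K -> x \in S.
  by have := in_setT x; rewrite -KS_cover in_setU => /orP[->|].
have edge_meets_K i j : P5 i j -> (f i \in K) || (f j \in K).
  by apply: contraTT; rewrite negb_or -fM => /andP[/notK_S iS /notK_S]; apply: S_stable.
have nadj_not_K i j : i != j -> ~~ P5 i j -> ~~ ((f i \in K) && (f j \in K)).
  move=> ij; apply: contra => /andP[iK jK].
  by rewrite -fM K_clique // (inj_eq fI).
move: (edge_meets_K (ord5 0) (ord5 1) isT) (edge_meets_K (ord5 3) (ord5 4) isT).
move: (nadj_not_K (ord5 0) (ord5 3) isT isT) (nadj_not_K (ord5 0) (ord5 4) isT isT).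
move: (nadj_not_K (ord5 1) (ord5 3) isT isT) (nadj_not_K (ord5 1) (ord5 4) isT isT).
by do 4!case: (_ \in K).
Qed.

Lemma split_graph_P5_antiP5_free (V : finType) (G : sgraph V) :
  split_graph G -> P5_antiP5_free G.
Proof.
move=> G_split; apply/P5_antiP5_freeP; split; first exact: split_graph_no_P5.
move=> /(full_hom_compl_left twin_free_compl_P5).
exact/split_graph_no_P5/split_graph_compl.
Qed.

(* An end of P5 has three non-neighbours, a vertex of C5 only two. *)
Lemma C5_no_P5 : ~ full_hom P5 C5.
Proof.
have two_nonneighbors (i j k l : 'I_5) : ~~ C5 i j -> ~~ C5 i k -> ~~ C5 i l ->
    [|| i == j, i == k, i == l, j == k, j == l | k == l].
  by move: i j k l; do 4![apply: ord5_ind].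
case=> f fM; have fI := twin_free_inj twin_free_P5 fM.
have := two_nonneighbors (f (ord5 0)) (f (ord5 2)) (f (ord5 3)) (f (ord5 4)).
by rewrite !fM !(inj_eq fI) => /(_ isT isT isT).
Qed.

Lemma C5_P5_antiP5_free : P5_antiP5_free C5.
Proof.
apply/P5_antiP5_freeP; split; first exact: C5_no_P5.
move=> /(full_hom_compl_left twin_free_compl_P5) P5C5c; apply: C5_no_P5.
apply: full_hom_trans P5C5c (isomorphic_full_hom _).
exact: isomorphic_sym C5_self_complementary.
Qed.

(** * Split divides *)

Record split_divide (V : finType) (G : sgraph V) (A B C L T : {set V}) : Prop :=
  SplitDivide {
    divide_disj :
      pairwise (fun X Y : {set V} => [disjoint X & Y]) [:: A; B; C; L; T];
    divide_L : clique G L;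
    divide_T : stable G T;
    divide_AB : complete G A B;
    divide_AC : anticomplete G A C;
    divide_AT : anticomplete G A T;
    divide_AL : exists2 x, x \in A & vcomplete G x L;
    divide_LB : complete G L B;
    divide_LC : complete G L C;
    divide_TC : anticomplete G T C;
    divide_CB : exists2 x, x \in C & vcomplete G x B;
    divide_agree :
      {in C, forall x, {in B &, forall b b', ~~ G b b' -> G x b = G x b'}} }.

Definition has_split_divide (V : finType) (G : sgraph V) : Prop :=
  exists A B C L T, [/\ split_divide G A B C L T,
    A :|: B :|: C :|: L :|: T = setT, 1 < #|A| & 1 < #|C|].

Lemma pairwise_disjoint5 (V : finType) (A B C L T : {set V}) :
  pairwise (fun X Y : {set V} => [disjoint X & Y]) [:: A; B; C; L; T] ->
  [disjoint A & B :|: C :|: L :|: T] /\ [disjoint C & A :|: B :|: L :|: T].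
Proof.
rewrite /= !andbT -!setI_eq0.
case/and4P=> /and4P[/eqP AB /eqP AC /eqP AL /eqP AT].
move=> /and3P[/eqP BC _ _] /andP[/eqP CL /eqP CT] _.
by rewrite !setIUr [C :&: A]setIC [C :&: B]setIC AB AC AL AT BC CL CT !setU0.
Qed.

Lemma split_divide_imset (V W : finType) (G : sgraph V) (H : sgraph W)
    (f : V -> W) (A B C L T : {set V}) :
  injective f -> {mono f : x y / G x y >-> H x y} ->
  split_divide G A B C L T ->
  split_divide H (f @: A) (f @: B) (f @: C) (f @: L) (f @: T).
Proof.
move=> fI fM [disj clL stT AB AC AT [x xA xL] LB LC TC [y yC yB] agree].
have complete_imset X Y : complete G X Y -> complete H (f @: X) (f @: Y).
  by move=> XY _ /imsetP[u uX ->] _ /imsetP[v vY ->]; rewrite fM XY.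
have anticomplete_imset X Y : anticomplete G X Y -> anticomplete H (f @: X) (f @: Y).
  by move=> XY _ /imsetP[u uX ->] _ /imsetP[v vY ->]; rewrite fM XY.
split; try by [apply: complete_imset | apply: anticomplete_imset].
- by move: disj; rewrite /= !(imset_disjoint fI).
- move=> _ _ /imsetP[u uL ->] /imsetP[v vL ->]; rewrite (inj_eq fI) fM.
  exact: clL.
- by move=> _ _ /imsetP[u uT ->] /imsetP[v vT ->]; rewrite fM; apply: stT.
- by exists (f x); [apply: imset_f | move=> _ /imsetP[u uL ->]; rewrite fM xL].
- by exists (f y); [apply: imset_f | move=> _ /imsetP[u uB ->]; rewrite fM yB].
move=> _ /imsetP[u uC ->] _ _ /imsetP[v vB ->] /imsetP[v' v'B ->]; rewrite !fM.
exact: agree.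
Qed.

Lemma has_split_divide_complK (V : finType) (G : sgraph V) :
  has_split_divide (compl (compl G)) -> has_split_divide G.
Proof.
case=> A [B [C [L [T [div cover A2 C2]]]]]; exists A, B, C, L, T; split=> //.
have idM : {mono id : x y / compl (compl G) x y >-> G x y}.
  by move=> x y; rewrite complK.
by have := split_divide_imset (@inj_id V) idM div; rewrite !imset_id.
Qed.

Lemma split_divide_no_P4_extension (V : finType) (G : sgraph V)
    (A B C L T : {set V}) a b l c n :
  split_divide G A B C L T ->
  a \in A -> b \in B -> l \in L -> c \in C -> n \in A :|: B :|: C :|: L :|: T ->
  ~~ G a l -> ~~ G b c -> ~~ extends_P4 G a b l c n.
Proof.
move=> div aA bB lL cC; rewrite /extends_P4 !inE -!orbA => nZ al bc.
case/or4P: nZ => [nA|nB|nC|/orP[nL|nT]].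
- by rewrite (divide_AB div nA bB) (negPf (divide_AC div nA cC)); do 2 case: (G n _).
- rewrite [G n a]adj_sym (divide_AB div aA nB) [G n l]adj_sym (divide_LB div lL nB).
  case nb: (G n b); case nc: (G n c) => //.
  have := divide_agree div cC bB nB; rewrite adj_sym nb => /(_ isT).
  by rewrite ![G c _]adj_sym nc (negPf bc).
- rewrite [G n a]adj_sym (negPf (divide_AC div aA nC)) [G n l]adj_sym.
  by rewrite (divide_LC div lL nC); do 2 case: (G n _).
- rewrite (divide_LB div nL bB) (divide_LC div nL cC).
  have [->|nl] := eqVneq n l; last by rewrite (divide_L div nL lL nl); case: (G n _).
  by rewrite [G l a]adj_sym (negPf al) adj_irr.
rewrite [G n a]adj_sym (negPf (divide_AT div aA nT)) (negPf (divide_TC div nT cC)).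
by do 2 case: (G n _).
Qed.

Lemma mixed_anticomponentP (V : finType) (G : sgraph V) (x : V) (S : {set V}) :
  (forall X, anticomponent G S X -> ~ mixed G x X) <->
  {in S &, forall y z, ~~ G y z -> G x y = G x z}.
Proof.
split=> [not_mixed y z yS zS yz|agree X [y yS ->] [ncomplete nanti]].
  have [-> //|yz_neq] := eqVneq y z.
  pose X := [set w in S | connect (anti_rel G S) y w].
  have yX : y \in X by rewrite inE yS connect0.
  have zX : z \in X by rewrite inE zS connect1 // /anti_rel yS zS compl_neq.
  apply/eqP/negPn/negP => xyz; apply: (not_mixed X); first by exists y.
  split=> [x_complete|x_anti]; case/eqP: xyz; first by rewrite !x_complete.
  by rewrite (negPf (x_anti y yX)) (negPf (x_anti z zX)).
have sym : connect_sym (anti_rel G S).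
  by apply: sym_connect_sym => p q; rewrite /anti_rel adj_sym andbCA.
have agree_step p q : anti_rel G S p q ->
    p \in [pred w | G x w == G x y] -> q \in [pred w | G x w == G x y].
  by case/and3P=> pS qS /compl_nadj pq; rewrite !inE (agree p q).
have agree_y z : connect (anti_rel G S) y z -> G x z = G x y.
  move=> yz; apply/eqP; have := closed_connect (intro_closed sym agree_step) yz.
  by rewrite !inE eqxx => <-.
case xy: (G x y) agree_y => agree_y.
  by apply: ncomplete => z; rewrite inE => /andP[_ /agree_y].
by apply: nanti => z; rewrite inE => /andP[_ /agree_y->].
Qed.

(** * Split unifications *)

Definition unif (U : finType) (G1 G2 : sgraph U) (A B C L T : {set U}) : sgraph U :=
  SGraph (unif_sym G1 G2 A B C L T) (unif_irr G1 G2 A B C L T).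

Section Unification.
Variables (U : finType) (G1 G2 : sgraph U) (A B C L T : {set U}) (a c : U).
Hypothesis comp : composable G1 G2 A B C L T a c.

Let E := unif G1 G2 A B C L T.

Let disj : [disjoint A & B :|: C :|: L :|: T] /\ [disjoint C & A :|: B :|: L :|: T] :=
  pairwise_disjoint5 (comp_disj comp).

Let inBLT x : x \in A :|: B :|: L :|: T -> x \in B :|: C :|: L :|: T ->
  x \in B :|: L :|: T.
Proof.
by move=> + /(disjointFl disj.1); rewrite !inE => + xA; rewrite xA.
Qed.

Lemma unif_part1 : {in A :|: B :|: L :|: T &, E =2 G1}.
Proof.
move=> x y x1 y1; rewrite /= /unif_rel x1 y1 /=.
case x2: (x \in _); last by rewrite orbF.
case y2: (y \in _); last by rewrite orbF.
by rewrite /= (comp12 comp) ?orbb ?inBLT.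
Qed.

Lemma unif_part2 : {in B :|: C :|: L :|: T &, E =2 G2}.
Proof.
move=> x y x2 y2; rewrite /= /unif_rel x2 y2 /=.
case x1: (x \in A :|: B :|: L :|: T) => //.
case y1: (y \in A :|: B :|: L :|: T) => //.
by rewrite /= (comp12 comp) ?orbb ?inBLT.
Qed.

Lemma unif_anticomplete : anticomplete E A C.
Proof.
move=> x xA y yC; rewrite /= /unif_rel.
by rewrite (disjointFr disj.1 xA) (disjointFr disj.2 yC) andbF.
Qed.

Lemma unif_split_divide : split_divide E A B C L T.
Proof.
have in1 x : [|| x \in A, x \in B, x \in L | x \in T] -> x \in A :|: B :|: L :|: T.
  by rewrite !inE -!orbA.
have in2 x : [|| x \in B, x \in C, x \in L | x \in T] -> x \in B :|: C :|: L :|: T.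
  by rewrite !inE -!orbA.
split.
- exact: comp_disj comp.
- move=> x y xL yL; rewrite unif_part1 ?in1 ?xL ?yL ?orbT //.
  exact: comp1_L comp _ _ xL yL.
- move=> x y xT yT; rewrite unif_part1 ?in1 ?xT ?yT ?orbT //.
  exact: comp1_T comp _ _ xT yT.
- by move=> x xA y yB; rewrite unif_part1 ?in1 ?xA ?yB ?orbT // (comp1_AB comp).
- exact: unif_anticomplete.
- by move=> x xA y yT; rewrite unif_part1 ?in1 ?xA ?yT ?orbT // (comp1_AT comp).
- have [x xA xL] := comp1_AL comp; exists x => // y yL.
  by rewrite unif_part1 ?in1 ?xA ?yL ?orbT // xL.
- move=> x xL y yB; rewrite unif_part2 ?in2 ?xL ?yB ?orbT //.
  by apply: (comp2_L comp) => //; rewrite inE yB.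
- move=> x xL y yC; rewrite unif_part2 ?in2 ?xL ?yC ?orbT //.
  by apply: (comp2_L comp) => //; rewrite inE yC orbT.
- by move=> x xT y yC; rewrite unif_part2 ?in2 ?xT ?yC ?orbT // (comp2_TC comp).
- have [x xC xB] := comp2_CB comp; exists x => // y yB.
  by rewrite unif_part2 ?in2 ?xC ?yB ?orbT // xB.
move=> x xC b b' bB b'B; rewrite !unif_part2 ?in2 ?xC ?bB ?b'B ?orbT //.
have /mixed_anticomponentP := fun X => @comp2_mixed _ _ _ _ _ _ _ _ _ _ comp x X xC.
exact.
Qed.

Let div := unif_split_divide.

Lemma unif_marker_a x v : x \in A -> v \in B :|: C :|: L :|: T ->
  (v \in L -> E x v) -> G2 a v = E x v.
Proof.
move=> xA; rewrite !inE -!orbA => /or4P[vB|vC|vL|vT] xv.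
- by rewrite (divide_AB div xA vB) (comp2_a comp) // inE vB.
- rewrite (negPf (divide_AC div xA vC)); apply/negbTE.
  by rewrite (comp2_aN comp) // inE vC.
- by rewrite xv // (comp2_a comp) // inE vL orbT.
rewrite (negPf (divide_AT div xA vT)); apply/negbTE.
by rewrite (comp2_aN comp) // inE vT orbT.
Qed.

Lemma unif_marker_c x v : x \in C -> v \in A :|: B :|: L :|: T ->
  (v \in B -> E x v) -> G1 c v = E x v.
Proof.
move=> xC; rewrite !inE -!orbA => /or4P[vA|vB|vL|vT] xv.
- rewrite [RHS]adj_sym (negPf (divide_AC div vA xC)); apply/negbTE.
  by rewrite (comp1_cN comp) // inE vA.
- by rewrite xv // (comp1_c comp) // inE vB.
- by rewrite [RHS]adj_sym (divide_LC div vL xC) (comp1_c comp) // inE vL orbT.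
rewrite [RHS]adj_sym (negPf (divide_TC div vT xC)); apply/negbTE.
by rewrite (comp1_cN comp) // inE vT orbT.
Qed.

Section Copy.
Variables (W : finType) (K : sgraph W) (f : W -> U).
Hypothesis K_prime : prime_graph K.
Hypothesis fZ : forall i, f i \in A :|: B :|: C :|: L :|: T.
Hypothesis fM : {mono f : i j / K i j >-> E i j}.

Let notA_part2 i : f i \notin A -> f i \in B :|: C :|: L :|: T.
Proof. by have := fZ i; rewrite !inE; case: (f i \in A). Qed.

Let notC_part1 i : f i \notin C -> f i \in A :|: B :|: L :|: T.
Proof. by have := fZ i; rewrite !inE; case: (f i \in C); rewrite //= orbF. Qed.

Lemma collapse_A_full_hom : (forall i j, f i \in A -> f j \in L -> K i j) ->
  full_hom K (part1 G1 A B L T c) \/ full_hom K (part2 G2 B C L T a).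
Proof.
move=> AL; pose h i := if f i \in A then a else f i.
have [i j|i j|allA|h_mono] := @prime_collapse _ _ K G2 [set i | f i \in A] h K_prime.
- by rewrite !inE /h => -> ->.
- rewrite inE /h => iA; rewrite (negPf iA) -fM.
  have [jA|jA] := boolP (f j \in A); last by rewrite unif_part2 ?notA_part2.
  rewrite adj_sym [RHS]adj_sym; apply: unif_marker_a => // [|iL].
    exact: notA_part2.
  by rewrite fM AL.
- left; have inA i : f i \in A by have := in_setT i; rewrite -allA inE.
  apply: (@full_hom_induced _ _ _ _ _ f) => [i|i j]; first by rewrite !inE inA.
  by rewrite -fM unif_part1 // !inE inA.
right; apply: full_hom_induced h_mono => i; rewrite /h.
case: ifPn => [_|/notA_part2 iZ]; first by rewrite !inE eqxx orbT.
by rewrite inE iZ.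
Qed.

Lemma collapse_C_full_hom : (forall i j, f i \in C -> f j \in B -> K i j) ->
  full_hom K (part1 G1 A B L T c) \/ full_hom K (part2 G2 B C L T a).
Proof.
move=> CB; pose h i := if f i \in C then c else f i.
have [i j|i j|allC|h_mono] := @prime_collapse _ _ K G1 [set i | f i \in C] h K_prime.
- by rewrite !inE /h => -> ->.
- rewrite inE /h => iC; rewrite (negPf iC) -fM.
  have [jC|jC] := boolP (f j \in C); last by rewrite unif_part1 ?notC_part1.
  rewrite adj_sym [RHS]adj_sym; apply: unif_marker_c => // [|iB].
    exact: notC_part1.
  by rewrite fM CB.
- right; have inC i : f i \in C by have := in_setT i; rewrite -allC inE.
  apply: (@full_hom_induced _ _ _ _ _ f) => [i|i j]; first by rewrite !inE inC orbT.
  by rewrite -fM unif_part2 // !inE inC orbT.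
left; apply: full_hom_induced h_mono => i; rewrite /h.
case: ifPn => [_|/notC_part1 iZ]; first by rewrite !inE eqxx orbT.
by rewrite inE iZ.
Qed.

End Copy.

Lemma unification_full_hom (W : finType) (K : sgraph W) :
  prime_graph K -> P4s_extend K ->
  full_hom K (split_unification G1 G2 A B C L T) ->
  full_hom K (part1 G1 A B L T c) \/ full_hom K (part2 G2 B C L T a).
Proof.
move=> K_prime K_extends [f0 f0M]; pose f i := val (f0 i).
have fZ i : f i \in A :|: B :|: C :|: L :|: T by apply: valP.
have fM : {mono f : i j / K i j >-> E i j} by [].
have [/existsP[i /existsP[l /and3P[iA lL il]]]|AL] :=
    boolP [exists i, exists l, [&& f i \in A, f l \in L & ~~ K i l]]; last first.
  apply: (collapse_A_full_hom K_prime fZ fM) => i l iA lL.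
  apply: contraNT AL => il.
  by apply/existsP; exists i; apply/existsP; exists l; apply/and3P.
have [/existsP[k /existsP[j /and3P[kC jB kj]]]|CB] :=
    boolP [exists k, exists j, [&& f k \in C, f j \in B & ~~ K k j]]; last first.
  apply: (collapse_C_full_hom K_prime fZ fM) => k j kC jB.
  apply: contraNT CB => kj.
  by apply/existsP; exists k; apply/existsP; exists j; apply/and3P.
have [||||||n] := K_extends i j l k; rewrite -?fM.
- exact: (divide_AB div).
- by rewrite adj_sym (divide_LB div).
- exact: (divide_LC div).
- by rewrite fM.
- exact: (divide_AC div).
- by rewrite adj_sym fM.
rewrite /extends_P4 -!fM => n_ext.
have := split_divide_no_P4_extension div iA jB lL kC (fZ n).
by rewrite /extends_P4 n_ext fM il adj_sym fM kj => /(_ isT isT).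
Qed.

End Unification.

Lemma substitution_P5_antiP5_free (V W : finType) (G : sgraph V) (x : V)
    (H : sgraph W) :
  P5_antiP5_free G -> P5_antiP5_free H -> P5_antiP5_free (substitution G x H).
Proof.
move=> /P5_antiP5_freeP[P5_G antiP5_G] /P5_antiP5_freeP[P5_H antiP5_H].
apply/P5_antiP5_freeP; split; first by case/(substitution_full_hom prime_P5).
by case/(substitution_full_hom (prime_compl prime_P5)).
Qed.

Lemma split_unification_P5_antiP5_free (U : finType) (G1 G2 : sgraph U)
    (A B C L T : {set U}) (a c : U) :
  composable G1 G2 A B C L T a c ->
  P5_antiP5_free (part1 G1 A B L T c) -> P5_antiP5_free (part2 G2 B C L T a) ->
  P5_antiP5_free (split_unification G1 G2 A B C L T).
Proof.
move=> comp /P5_antiP5_freeP[P5_1 antiP5_1] /P5_antiP5_freeP[P5_2 antiP5_2].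
apply/P5_antiP5_freeP; split.
  by case/(unification_full_hom comp prime_P5 P4s_extend_P5).
by case/(unification_full_hom comp (prime_compl prime_P5) P4s_extend_compl_P5).
Qed.

Lemma generated_P5_antiP5_free (V : finType) (G : sgraph V) :
  generated G -> P5_antiP5_free G.
Proof.
elim=> {V G}.
- move=> V G /isomorphic_full_hom/P5_antiP5_free_full_hom; apply.
  exact: C5_P5_antiP5_free.
- exact: split_graph_P5_antiP5_free.
- move=> V V0 W G G0 x H _ G0_free _ H_free.
  move=> /isomorphic_full_hom/P5_antiP5_free_full_hom; apply.
  exact: substitution_P5_antiP5_free.
- move=> V U G G1 G2 A B C L T a c comp _ free1 _ free2.
  move=> /isomorphic_full_hom/P5_antiP5_free_full_hom; apply.
  exact: split_unification_P5_antiP5_free comp free1 free2.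
move=> V U G G1 G2 A B C L T a c comp _ /compl_P5_antiP5_free free1.
move=> _ /compl_P5_antiP5_free free2 /isomorphic_full_hom iso.
apply/compl_P5_antiP5_free; apply: P5_antiP5_free_full_hom iso _.
exact: split_unification_P5_antiP5_free comp free1 free2.
Qed.

(** * Undoing the operations *)

Variant substitution_of_smaller (V : finType) (G : sgraph V) : Prop :=
  SubstitutionOfSmaller (V0 W : finType) (G0 : sgraph V0) (x : V0) (H : sgraph W)
    of isomorphic G (substitution G0 x H)
    & full_hom G0 G & #|V0| < #|V| & full_hom H G & #|W| < #|V|.

Lemma homogeneous_substitution (V : finType) (G : sgraph V) (M : {set V}) :
  proper_homogeneous G M -> substitution_of_smaller G.
Proof.
case=> M_hom M_gt1 MT; have /card_gt0P[m mM] : 0 < #|M| by exact: ltnW.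
pose r (o : option {v | v \in ~: M}) := if o is Some u then val u else m.
apply: (@SubstitutionOfSmaller _ _ _ {x | x \in M} (pullback r G) None (induced G M)).
- apply: isomorphic_sym.
  pose g (p : {v : option {v | v \in ~: M} | v != None} + {x | x \in M}) : V :=
    match p with inl u => r (val u) | inr s => val s end.
  have rM (u : {v : option {v | v \in ~: M} | v != None}) : r (val u) \notin M.
    by case: u => [[[v]|//]] /=; rewrite inE.
  exists g; last first.
    move=> [u|s] [v|t] //=; first by apply: (M_hom (r (val u))) => //; apply: valP.
    by rewrite ![G _ (r _)]adj_sym; apply: (M_hom (r (val v))) => //; apply: valP.
  apply: inj_card_bij; last first.
    by rewrite card_sum !card_sig (cardC1 None) card_option card_sig addnC cardsC.
  move=> [u|s] [v|t] /=.
  + case: u v => [[u|//] ?] [[v|//] ?] /= /val_inj uv; congr inl.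
    by apply: val_inj; rewrite /= uv.
  + by move=> rus; have := rM u; rewrite rus (valP t).
  + by move=> srv; have := rM v; rewrite -srv (valP s).
  by move/val_inj->.
- exact: pullback_full_hom.
- by rewrite card_option card_sig -(cardsC M) -[X in X < _]add1n ltn_add2r.
- exact: induced_full_hom.
by rewrite card_sig -cardsT; apply: proper_card; rewrite properT.
Qed.

Variant unification_of_smaller (V : finType) (G : sgraph V) : Prop :=
  UnificationOfSmaller (U : finType) (H : sgraph U) (A B C L T : {set U}) (a c : U)
    of composable H H A B C L T a c
    & isomorphic G (split_unification H H A B C L T)
    & full_hom (part1 H A B L T c) G & #|A :|: B :|: L :|: T :|: [set c]| < #|V|
    & full_hom (part2 H B C L T a) G & #|B :|: C :|: L :|: T :|: [set a]| < #|V|.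

Lemma split_divide_composable (U : finType) (G : sgraph U) (A B C L T : {set U})
    (a c x y : U) :
  split_divide G A B C L T -> a != c ->
  a \notin A :|: B :|: C :|: L :|: T -> c \notin A :|: B :|: C :|: L :|: T ->
  x \in A -> vcomplete G x L -> G a =1 G x ->
  y \in C -> vcomplete G y B -> G c =1 G y ->
  composable G G A B C L T a c.
Proof.
move=> div ac aZ cZ xA xL ax yC yB cy; split=> //; try by case: div.
- by apply/set0Pn; exists x.
- by apply/set0Pn; exists y.
- move=> v; rewrite inE cy => /orP[/yB //|vL].
  by rewrite adj_sym (divide_LC div).
- move=> v; rewrite inE cy adj_sym => /orP[vA|vT]; first exact: (divide_AC div).
  exact: (divide_TC div).
- move=> l lL v; rewrite inE => /orP[vB|vC]; first exact: (divide_LB div).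
  exact: (divide_LC div).
- by move=> v; rewrite inE ax => /orP[vB|/xL //]; apply: (divide_AB div).
- move=> v; rewrite inE ax => /orP[vC|vT]; first exact: (divide_AC div).
  exact: (divide_AT div).
move=> z X zC; move: X; apply/mixed_anticomponentP; exact: divide_agree div _ zC.
Qed.

Lemma split_divide_unif (U : finType) (G : sgraph U) (A B C L T : {set U}) :
  split_divide G A B C L T ->
  {in A :|: B :|: C :|: L :|: T &, unif G G A B C L T =2 G}.
Proof.
move=> div x y; rewrite /= /unif_rel !inE -!orbA => xZ yZ.
case xy: (G x y); last by rewrite !andbF.
have xyAC : ~~ ((x \in A) && (y \in C)).
  by apply/negP => /andP[xA yC]; rewrite (negPf (divide_AC div xA yC)) in xy.
have xyCA : ~~ ((x \in C) && (y \in A)).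
  by apply/negP => /andP[xC yA]; rewrite adj_sym (negPf (divide_AC div yA xC)) in xy.
move: xZ yZ xyAC xyCA.
by do 5![case: (x \in _)] => //=; do 5![case: (y \in _)].
Qed.

(* The marker vertices are [inr true], a twin of [x], and [inr false], a twin
   of [y]. *)
Lemma split_divide_unification (V : finType) (G : sgraph V) :
  has_split_divide G -> unification_of_smaller G.
Proof.
case=> A [B [C [L [T [div cover A2 C2]]]]].
have [x xA xL] := divide_AL div; have [y yC yB] := divide_CB div.
pose r (u : V + bool) := match u with inl v => v | inr b => if b then x else y end.
pose emb : V -> V + bool := inl.
have emb_inj : injective emb by move=> u v [].
have embM : {mono emb : u v / G u v >-> pullback r G u v} by [].
have div' := split_divide_imset emb_inj embM div.
have inr_notin (b : bool) (X : {set V}) : inr b \notin emb @: X by apply/imsetP=> -[].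
have inr_notin5 (b : bool) : inr b \notin
    emb @: A :|: emb @: B :|: emb @: C :|: emb @: L :|: emb @: T.
  by rewrite !in_setU !negb_or !inr_notin.
have [AZ CZ] := pairwise_disjoint5 (divide_disj div).
have card_part (X Y : {set V}) (u : V + bool) :
    [disjoint X & Y] -> 1 < #|X| -> #|emb @: Y :|: [set u]| < #|V|.
  move=> XY X2; apply: leq_ltn_trans (leq_card_setU _ _) _.
  rewrite cards1 card_imset // addnC; apply: leq_trans (max_card [in X :|: Y]).
  by rewrite cardsU disjoint_setI0 // cards0 subn0 ltn_add2r.
apply: (UnificationOfSmaller (a := inr true) (c := inr false)).
- apply: (split_divide_composable div' _ (inr_notin5 true) (inr_notin5 false)
    (imset_f emb xA) _ _ (imset_f emb yC)) => //.
    by move=> _ /imsetP[l lL ->]; apply: xL.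
  by move=> _ /imsetP[b bB ->]; apply: yB.
- have embZ v : emb v \in emb @: A :|: emb @: B :|: emb @: C :|: emb @: L :|: emb @: T.
    by rewrite -!imsetU cover imset_f.
  exists (fun v => exist _ (emb v) (embZ v)) => [|u v].
    exists (fun u => r (val u)) => [//|[[v|b] uZ]]; apply: val_inj => //=.
    by rewrite (negPf (inr_notin5 b)) in uZ.
  exact: (split_divide_unif div' (embZ u) (embZ v)).
- exact: full_hom_trans (induced_full_hom _ _) (pullback_full_hom _ _).
- by rewrite -!imsetU (card_part C).
- exact: full_hom_trans (induced_full_hom _ _) (pullback_full_hom _ _).
by rewrite -!imsetU (card_part A).
Qed.

(** * Attachments to connected sets *)

Section ForbiddenPatterns.
Variables (V : finType) (G : sgraph V).

Definition P5_free : Prop := forall a b c d e,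
  G a b -> G b c -> G c d -> G d e -> ~~ G a c -> ~~ G a d -> ~~ G a e ->
  ~~ G b d -> ~~ G b e -> ~~ G c e -> False.

(* The complement of P5 is the 4-cycle [a b c d] with a roof [e] on [a b]. *)
Definition house_free : Prop := forall a b c d e,
  G a b -> G b c -> G c d -> G d a -> G e a -> G e b ->
  ~~ G a c -> ~~ G b d -> ~~ G e c -> ~~ G e d -> False.

Definition C5_free : Prop := forall a b c d e,
  G a b -> G b c -> G c d -> G d e -> G e a -> ~~ G a c -> ~~ G b d ->
  ~~ G c e -> ~~ G d a -> ~~ G e b -> False.

Definition P5_house_C5_free : Prop := [/\ P5_free, house_free & C5_free].

Lemma no_full_hom_P5_free : ~ full_hom P5 G -> P5_free.
Proof.
move=> nP5 a b c d e ab bc cd de ac ad ae bd be ce; apply: nP5.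
exists (fun i : 'I_5 => nth a [:: a; b; c; d; e] i).
by do 2![apply: ord5_ind]; rewrite /= ?adj_irr //;
  first [exact/negbTE | rewrite adj_sym //; exact/negbTE].
Qed.

Lemma no_full_hom_house_free : ~ full_hom (compl P5) G -> house_free.
Proof.
move=> nhouse a b c d e ab bc cd da ea eb ac bd ec ed; apply: nhouse.
exists (fun i : 'I_5 => nth a [:: a; c; e; d; b] i).
by do 2![apply: ord5_ind]; rewrite /= ?adj_irr //;
  first [exact/negbTE | rewrite adj_sym //; exact/negbTE].
Qed.

Lemma no_full_hom_C5_free : ~ full_hom C5 G -> C5_free.
Proof.
move=> nC5 a b c d e ab bc cd de ea ac bd ce da eb; apply: nC5.
exists (fun i : 'I_5 => nth a [:: a; b; c; d; e] i).
by do 2![apply: ord5_ind]; rewrite /= ?adj_irr //;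
  first [exact/negbTE | rewrite adj_sym //; exact/negbTE].
Qed.

Definition has_neighbor (u : V) (D : {set V}) : Prop := exists2 x, x \in D & G u x.

Definition has_nonneighbor (u : V) (D : {set V}) : Prop :=
  exists2 x, x \in D & ~~ G u x.

Definition connected_set (D : {set V}) : Prop := forall (X : pred V) x y,
  x \in D -> y \in D -> X x -> ~~ X y ->
  exists p q, [/\ p \in D, q \in D, X p, ~~ X q & G p q].

Lemma mixed_vcomplete D D' u : P5_free ->
  connected_set D -> connected_set D' -> anticomplete G D D' ->
  has_neighbor u D -> has_nonneighbor u D -> has_neighbor u D' ->
  vcomplete G u D'.
Proof.
move=> nP5 cD cD' DD' [x xD ux] [y yD uy] [z zD' uz] w wD'; apply/negPn/negP => uw.
have [p [q [pD qD up uq pq]]] := cD (G u) x y xD yD ux uy.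
have [p' [q' [pD' qD' up' uq' p'q']]] := cD' (G u) z w zD' wD' uz uw.
have qp' := DD' _ qD _ pD'; have qq' := DD' _ qD _ qD'.
have pp' := DD' _ pD _ pD'; have pq' := DD' _ pD _ qD'.
by apply: (nP5 q p u p' q'); adj_done.
Qed.

End ForbiddenPatterns.

Section AnchoredAttachment.
Variables (V : finType) (G : sgraph V) (D : {set V}) (d : V).
Hypotheses (D_connected : connected_set G D) (dD : vanticomplete G d D).

Lemma common_neighbor u a : P5_free G -> G u d -> has_neighbor G u D ->
  a \in D -> ~~ G u a -> exists p, [/\ p \in D, G u p & G p a].
Proof.
move=> nP5 ud [x xD ux] aD ua.
pose X v := G u v || [exists w in D, G u w && G w v].
have [/orP[ua'|/exists_inP[p pD /andP[up pa]]]|nXa] := boolP (X a).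
- by rewrite ua' in ua.
- by exists p.
have [|p [q [pD qD Xp nXq pq]]] := D_connected xD aD _ nXa; first by rewrite /X ux.
move: nXq; rewrite /X negb_or negb_exists_in => /andP[uq /forall_inP no_common].
have up : ~~ G u p by apply: contraL pq => up; have := no_common p pD; rewrite up.
move: Xp; rewrite /X (negPf up) => /exists_inP[w wD /andP[uw wp]].
have wq : ~~ G w q by have := no_common w wD; rewrite uw.
have dq := dD qD; have dp := dD pD; have dw := dD wD.
by case: (nP5 q p w u d); adj_done.
Qed.

Lemma nonadjacent_agree u v : P5_house_C5_free G ->
  G u d -> G v d -> ~~ G u v -> has_neighbor G u D -> has_neighbor G v D ->
  {in D, G u =1 G v}.
Proof.
case=> nP5 nhouse nC5.
have neighbor_imp s t : G s d -> G t d -> ~~ G s t -> has_neighbor G t D ->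
    forall p, p \in D -> G s p -> G t p.
  move=> sd td st tD p pD sp; apply/negPn/negP => tp.
  have [q [qD tq qp]] := common_neighbor nP5 td tD pD tp.
  have dp := dD pD; have dq := dD qD.
  have [sq|sq] := boolP (G s q); first by apply: (nhouse s q t d p); adj_done.
  by apply: (nC5 p q t d s); adj_done.
move=> ud vd uv uD vD p pD; apply/idP/idP; first exact: neighbor_imp.
by apply: neighbor_imp; adj_done.
Qed.

(* A vertex [a] of [D] with the most neighbours in [M]: if it missed [u] in [M],
   a common neighbour [p] of [u] and [a] in [D] would miss some neighbour [v] of
   [a] in [M], giving a house with roof [d]. *)
Lemma dominating_vertex (M : {set V}) : P5_house_C5_free G -> D != set0 ->
  {in M, forall u, G u d} -> {in M, forall u, has_neighbor G u D} ->
  exists2 a, a \in D & vcomplete G a M.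
Proof.
move=> Gfree /set0Pn[x0 x0D] Md MD; have [nP5 nhouse _] := Gfree.
case: (@arg_maxnP V x0 (mem D) (fun a => #|[set u in M | G u a]|) x0D) => a aD amax.
exists a => // u uM; apply/negPn/negP; rewrite adj_sym => ua.
have [p [pD up pa]] := common_neighbor nP5 (Md _ uM) (MD _ uM) aD ua.
have [/exists_inP[v vM /andP[va vp]]|none] :=
    boolP [exists v in M, G v a && ~~ G v p].
  have [uv|uv] := boolP (G u v).
    have := dD pD; have := dD aD; have := Md _ uM; have := Md _ vM.
    by move=> *; apply: (nhouse u v a p d); adj_done.
  have := nonadjacent_agree Gfree (Md _ uM) (Md _ vM) uv (MD _ uM) (MD _ vM) pD.
  by rewrite up (negPf vp).
have : #|[set w in M | G w p]| <= #|[set w in M | G w a]| := amax p pD.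
rewrite leqNgt => /negP; apply; apply: proper_card.
apply/properP; split; last by exists u; rewrite !inE uM ?up.
apply/subsetP => w; rewrite !inE => /andP[wM wa]; rewrite wM /=.
by apply: contraNT none => wp; apply/exists_inP; exists w; rewrite ?wa.
Qed.

End AnchoredAttachment.

(** * Minimal cutsets *)

Section Components.
Variables (V : finType) (G : sgraph V).
Implicit Types (S D : {set V}) (x y : V).

Definition avoid_rel S : rel V := fun x y => [&& x \notin S, y \notin S & G x y].

Definition component S x : {set V} := [set y | connect (avoid_rel S) x y].

Definition nontrivial S x : bool :=
  (x \notin S) && [exists y, (y \notin S) && G x y].

Definition separates x S : bool :=
  nontrivial S x && [exists y, nontrivial S y && (y \notin component S x)].

Lemma avoid_connect_sym S : connect_sym (avoid_rel S).
Proof. by apply: sym_connect_sym => x y; rewrite /avoid_rel adj_sym andbCA. Qed.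

Lemma component_refl S x : x \in component S x.
Proof. by rewrite inE connect0. Qed.

Lemma component_sub S x D : x \in D ->
  (forall p q, avoid_rel S p q -> p \in D -> q \in D) -> component S x \subset D.
Proof.
move=> xD D_closed; apply/subsetP => y; rewrite inE => xy.
by rewrite -(closed_connect (intro_closed (avoid_connect_sym S) D_closed) xy).
Qed.

Lemma component_notin S x y : x \notin S -> y \in component S x -> y \notin S.
Proof.
move=> xS; suff /subsetP sub : component S x \subset ~: S by move=> /sub; rewrite inE.
by apply: component_sub; [rewrite inE | move=> p q /and3P[_ qS _] _; rewrite inE].
Qed.

Lemma component_eq S x y : y \in component S x -> component S y = component S x.
Proof.
rewrite inE => xy; apply/setP => z; rewrite !inE.
by rewrite (same_connect (avoid_connect_sym S) xy).
Qed.

Lemma component_sym S x y : (y \in component S x) = (x \in component S y).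
Proof. by rewrite !inE avoid_connect_sym. Qed.

Lemma component_step S x p q : p \notin S -> q \notin S -> G p q ->
  p \in component S x -> q \in component S x.
Proof.
rewrite !inE => pS qS pq xp; apply: connect_trans xp (connect1 _).
by rewrite /avoid_rel pS qS.
Qed.

Lemma component_anticomplete S x y : x \notin S -> y \notin S ->
  y \notin component S x -> anticomplete G (component S x) (component S y).
Proof.
move=> xS yS yx p px q qy; apply: contra yx => pq.
have pS := component_notin xS px; have qS := component_notin yS qy.
by rewrite -(component_eq (component_step pS qS pq px)) component_sym.
Qed.

Lemma component_connected S x : x \notin S -> connected_set G (component S x).
Proof.
move=> xS X y z yx zx Xy nXz.
have [/exists_inP[p px /exists_inP[q qx /and3P[Xp nXq pq]]]|nex] :=
    boolP [exists p in component S x, exists q in component S x,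
             [&& X p, ~~ X q & G p q]].
  by exists p, q.
pose P w := (w \in component S x) && X w.
suff /subsetP/(_ z) : component S y \subset [set w | P w].
  by rewrite (component_eq yx) zx [_ \in _]in_set /P (negPf nXz) andbF => /(_ isT).
apply: component_sub => [|p q /and3P[pS qS pq]]; first by rewrite in_set /P yx.
rewrite [p \in _]in_set [q \in _]in_set => /andP[px Xp].
have qx := component_step pS qS pq px; rewrite /P qx; apply: contraNT nex => nXq.
by apply/exists_inP; exists p => //; apply/exists_inP; exists q; rewrite // Xp nXq.
Qed.

Definition incomplete_on S x : {set V} :=
  [set s in S | ~~ [forall z in component S x, G s z]].

Lemma incomplete_onP S x s :
  reflect (s \in S /\ has_nonneighbor G s (component S x)) (s \in incomplete_on S x).
Proof.
rewrite inE negb_forall_in; apply: (iffP andP) => -[sS].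
  by case/exists_inP=> z zx sz; split=> //; exists z.
by case=> z zx sz; split=> //; apply/exists_inP; exists z.
Qed.

Lemma nontrivial_notin S x : nontrivial S x -> x \notin S.
Proof. by case/andP. Qed.

Lemma edge_nontrivial S x y : x \notin S -> y \notin S -> G x y -> nontrivial S x.
Proof.
by move=> xS yS xy; rewrite /nontrivial xS; apply/existsP; exists y; rewrite yS.
Qed.

Lemma trivial_nadj S x y : x \notin S -> y \notin S -> ~~ nontrivial S x -> ~~ G x y.
Proof. by move=> xS yS; apply: contra; apply: edge_nontrivial. Qed.

Lemma nontrivial_component S x y :
  nontrivial S x -> y \in component S x -> nontrivial S y.
Proof.
case/andP=> xS /existsP[z /andP[zS xz]] yx; have yS := component_notin xS yx.
have [->|yx_neq] := eqVneq y x; first exact: edge_nontrivial xz.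
have nyx : ~~ pred1 y x by rewrite /= eq_sym.
have [p [q [px qx /eqP <- _ pq]]] :=
  component_connected xS (X := pred1 y) yx (component_refl S x) (eqxx y) nyx.
exact: edge_nontrivial (component_notin xS px) (component_notin xS qx) pq.
Qed.

Lemma nontrivial_card S x : nontrivial S x -> 1 < #|component S x|.
Proof.
case/andP=> xS /existsP[z /andP[zS xz]]; apply/card_gt1P; exists x, z.
split; first exact: component_refl.
  exact: component_step xz (component_refl _ _).
by apply: contraTneq xz => ->; rewrite adj_irr.
Qed.

Lemma nontrivial_sub S S' x : S' \subset S -> nontrivial S x -> nontrivial S' x.
Proof.
move=> /subsetP SS /andP[xS /existsP[y /andP[yS xy]]].
by apply: edge_nontrivial xy; [apply: contra xS|apply: contra yS]; apply: SS.
Qed.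

Record full_cutset S x y : Prop := FullCutset {
  cutset_x : nontrivial S x;
  cutset_y : nontrivial S y;
  cutset_sep : y \notin component S x;
  cutset_neighbor s z :
    s \in S -> nontrivial S z -> has_neighbor G s (component S z) }.

Lemma full_cutset_sym S x y : full_cutset S x y -> full_cutset S y x.
Proof. by case=> ntx nty yx nbr; split=> //; rewrite component_sym. Qed.

(* If [s] missed a nontrivial component, that component would survive the
   removal of [s] from [S], and [S :\ s] would still separate. *)
Lemma minset_has_neighbor x S s z : minset (separates x) S ->
  s \in S -> nontrivial S z -> has_neighbor G s (component S z).
Proof.
case/minsetP=> /andP[ntx /existsP[w /andP[ntw wx]]] Smin sS ntz.
have [/exists_inP //|none] := boolP [exists p in component S z, G s p].
have xS := nontrivial_notin ntx; have zS := nontrivial_notin ntz.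
have sub : S :\ s \subset S by exact: subD1set.
have survives y : y \in component S z -> component (S :\ s) y \subset component S z.
  move=> yz; apply: component_sub => // p q /and3P[pS qS pq] pz.
  have pS' := component_notin zS pz.
  have qs : q != s.
    apply: contraNneq none => qs; apply/exists_inP; exists p => //.
    by rewrite adj_sym -qs.
  by apply: (component_step pS' _ pq pz); move: qS; rewrite !inE qs.
suff /Smin/(_ sub) SE : separates x (S :\ s) by move: sS; rewrite -SE !inE eqxx.
rewrite /separates (nontrivial_sub sub) //=; apply/existsP.
have [zx|zx] := boolP (z \in component S x).
  exists w; rewrite (nontrivial_sub sub) //=; apply: contra wx => wx.
  by rewrite -(component_eq zx) (subsetP (survives x _)) // component_sym.
exists z; rewrite (nontrivial_sub sub) //=; apply: contra zx => zx.
by rewrite component_sym (subsetP (survives z _)) ?component_refl // component_sym.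
Qed.

Lemma full_cutset_exists (W : {set V}) x x' v v' :
  x \in W -> x' \in W -> G x x' -> G v v' -> v \notin W ->
  vanticomplete G v W -> vanticomplete G v' W ->
  exists S y, full_cutset S x y /\ [disjoint W & S].
Proof.
move=> xW x'W xx' vv' vW vW_anti v'W_anti; set S0 := ~: (W :|: [set v; v']).
have notin_S0 z : z \notin S0 = [|| z \in W, z == v | z == v'].
  by rewrite !inE negbK.
have sub : component S0 x \subset W.
  apply: component_sub => // p q /and3P[_]; rewrite notin_S0 => qS pq pW.
  case/or3P: qS => // /eqP qv; move: pq; rewrite qv adj_sym.
    by rewrite (negPf (vW_anti _ pW)).
  by rewrite (negPf (v'W_anti _ pW)).
have /minset_exists[S Smin SS0] : separates x S0.
  apply/andP; split; first by rewrite (edge_nontrivial _ _ xx') // notin_S0 ?xW ?x'W.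
  apply/existsP; exists v; rewrite (contra (subsetP sub v) vW) andbT.
  by rewrite (edge_nontrivial _ _ vv') // notin_S0 eqxx ?orbT.
have /andP[ntx /existsP[y /andP[nty yx]]] := minsetp Smin.
exists S, y; split; first by split=> // s z; apply: minset_has_neighbor Smin.
by rewrite disjoint_sym disjoints_subset (subset_trans SS0) // setCS subsetUl.
Qed.

End Components.

(** * From cutsets to split divides *)

Section CutsetDivide.
Variables (V : finType) (G : sgraph V) (S : {set V}) (x y : V).
Hypothesis Gfree : P5_house_C5_free G.
Hypothesis cut : full_cutset G S x y.

Let A := component G S x.
Let L := incomplete_on G S x.
Let B := S :\: L.
Let C := [set z | nontrivial G S z] :\: A.
Let T := ~: S :\: [set z | nontrivial G S z].

Let xS : x \notin S. Proof. exact: nontrivial_notin (cutset_x cut). Qed.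
Let A_connected : connected_set G A. Proof. exact: component_connected. Qed.

Let A_notin z : z \in A -> z \notin S. Proof. exact: component_notin. Qed.

Let A_nontrivial z : z \in A -> nontrivial G S z.
Proof. exact: nontrivial_component (cutset_x cut). Qed.

Let L_sub l : l \in L -> l \in S. Proof. by case/incomplete_onP. Qed.

Let CP z : z \in C -> nontrivial G S z /\ z \notin A.
Proof. by rewrite in_setD inE => /andP[]. Qed.

Let C_notin z : z \in C -> z \notin S. Proof. by case/CP=> /nontrivial_notin. Qed.

Let TP z : z \in T -> z \notin S /\ ~~ nontrivial G S z.
Proof. by rewrite in_setD !inE => /andP[]. Qed.

Let A_neighbor s : s \in S -> has_neighbor G s A.
Proof. by move=> sS; apply: (cutset_neighbor cut sS (cutset_x cut)). Qed.

Let component_C z : z \in C -> anticomplete G A (component G S z).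
Proof. by case/CP=> /nontrivial_notin zS zA; apply: component_anticomplete. Qed.

Let C_anticomplete z : z \in C -> vanticomplete G z A.
Proof.
move=> zC a aA; rewrite adj_sym; apply: (component_C zC aA); exact: component_refl.
Qed.

Let component_y z : z \in component G S y -> z \in C.
Proof.
move=> zy; rewrite in_setD inE (nontrivial_component (cutset_y cut) zy) andbT.
by apply: contra (cutset_sep cut) => /component_eq <-; rewrite component_sym.
Qed.

Let BA b a : b \in B -> a \in A -> G b a.
Proof.
move=> /setDP[bS bL] aA; apply/negPn/negP => ba; case/negP: bL.
by apply/incomplete_onP; split=> //; exists a.
Qed.

Lemma incomplete_vcomplete l z : l \in incomplete_on G S x ->
  nontrivial G S z -> z \notin component G S x ->
  vcomplete G l (component G S z).
Proof.
move=> /incomplete_onP[lS lA] ntz zA; have [nP5 _ _] := Gfree.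
have zS := nontrivial_notin ntz.
apply: (mixed_vcomplete nP5 A_connected (component_connected zS) _ (A_neighbor lS) lA).
  exact: component_anticomplete.
exact: (cutset_neighbor cut lS ntz).
Qed.

Let LC : complete G L C.
Proof.
move=> l lL z /CP[ntz zA]; apply: (incomplete_vcomplete lL ntz zA).
exact: component_refl.
Qed.

Lemma incomplete_complete :
  complete G (incomplete_on G S x) (S :\: incomplete_on G S x).
Proof.
move=> l lL b bB; apply/negPn/negP => lb.
have [lS [z zA lz]] := incomplete_onP _ _ _ _ lL; have [bS _] := setDP bB.
have [w wy bw] := cutset_neighbor cut bS (cutset_y cut).
have wC := component_y wy.
have := nonadjacent_agree A_connected (C_anticomplete wC) Gfree (LC lL wC) bw lb
  (A_neighbor lS) (A_neighbor bS) zA.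
by rewrite (negPf lz) BA.
Qed.

Let AL : exists2 a, a \in A & vcomplete G a L.
Proof.
have yC := component_y (component_refl G S y).
apply: (dominating_vertex A_connected (C_anticomplete yC) Gfree).
- by apply/set0Pn; exists x; apply: component_refl.
- by move=> l lL; apply: LC.
by move=> l /L_sub; apply: A_neighbor.
Qed.

Let CB : exists2 z, z \in C & vcomplete G z B.
Proof.
have yS := nontrivial_notin (cutset_y cut).
have yC := component_y (component_refl G S y).
have x_anti : vanticomplete G x (component G S y).
  by apply: (component_C yC); apply: component_refl.
have [|||z /component_y zC zB] :=
    dominating_vertex (M := B) (component_connected yS) x_anti Gfree; last by exists z.
- by apply/set0Pn; exists y; apply: component_refl.
- by move=> b bB; apply: BA => //; apply: component_refl.
by move=> b /setDP[bS _]; apply: (cutset_neighbor cut bS (cutset_y cut)).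
Qed.

Let C_agree : {in C, forall z, {in B &, forall b b', ~~ G b b' -> G z b = G z b'}}.
Proof.
move=> z zC b b' bB b'B bb'; have [ntz _] := CP zC; rewrite ![G z _]adj_sym.
have x_anti : vanticomplete G x (component G S z).
  by apply: (component_C zC); apply: component_refl.
have [bS _] := setDP bB; have [b'S _] := setDP b'B.
have xA : x \in A by apply: component_refl.
have Dz_connected : connected_set G (component G S z).
  exact: component_connected (nontrivial_notin ntz).
apply: (nonadjacent_agree Dz_connected x_anti Gfree (BA bB xA) (BA b'B xA) bb'
  (cutset_neighbor cut bS ntz) (cutset_neighbor cut b'S ntz)).
exact: component_refl.
Qed.

Let parts_disjoint :
  pairwise (fun X Y : {set V} => [disjoint X & Y]) [:: A; B; C; L; T].
Proof.
rewrite /= !andbT -!setI_eq0; do ![apply/andP; split];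
  apply/eqP/setP => z; rewrite in_set0; apply/negP => /setIP[].
- by move=> /A_notin zS /setDP[]; rewrite (negPf zS).
- by move=> zA /CP[_]; rewrite zA.
- by move=> /A_notin zS /L_sub; rewrite (negPf zS).
- by move=> /A_nontrivial ntz /TP[_]; rewrite ntz.
- by case/setDP=> zS _ /C_notin; rewrite zS.
- by case/setDP=> _ /negP.
- by case/setDP=> zS _ /TP[]; rewrite zS.
- by move=> /C_notin zS /L_sub; rewrite (negPf zS).
- by move=> /CP[ntz _] /TP[_]; rewrite ntz.
by move=> /L_sub zS /TP[]; rewrite zS.
Qed.

Let parts_cover : A :|: B :|: C :|: L :|: T = setT.
Proof.
apply/setP => z; rewrite in_setT !in_setU /B /C /T !in_setD in_setC.
rewrite [z \in [set w | _]]in_set.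
by case: (z \in A); case: (z \in L); case: (z \in S); case: (nontrivial G S z).
Qed.

Lemma full_cutset_split_divide :
  clique G (incomplete_on G S x) -> has_split_divide G.
Proof.
move=> L_clique; exists A, B, C, L, T; split; last 3 first.
- exact: parts_cover.
- exact: nontrivial_card (cutset_x cut).
- apply: leq_trans (nontrivial_card (cutset_y cut)) (subset_leq_card _).
  by apply/subsetP => z; apply: component_y.
split.
- exact: parts_disjoint.
- exact: L_clique.
- by move=> s t /TP[sS ntsN] /TP[tS _]; apply: trivial_nadj sS tS ntsN.
- by move=> a aA b bB; rewrite adj_sym BA.
- by move=> a aA z zC; rewrite adj_sym C_anticomplete.
- by move=> a /A_notin aS t /TP[tS ttN]; rewrite adj_sym (trivial_nadj tS aS ttN).
- exact: AL.
- exact: incomplete_complete.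
- exact: LC.
- by move=> t /TP[tS ttN] z /C_notin zS; apply: trivial_nadj tS zS ttN.
- exact: CB.
exact: C_agree.
Qed.

End CutsetDivide.

Section TwoCutsets.
Variables (V : finType) (G : sgraph V) (S : {set V}) (x y u : V).
Hypotheses (Gfree : P5_house_C5_free G) (Gcfree : P5_house_C5_free (compl G)).
Hypothesis cut : full_cutset G S x y.
Hypothesis u_incomplete : u \in incomplete_on G S x.

Let xS : x \notin S. Proof. exact: nontrivial_notin (cutset_x cut). Qed.
Let yS : y \notin S. Proof. exact: nontrivial_notin (cutset_y cut). Qed.

Lemma incomplete_on_y_vcomplete v :
  v \in incomplete_on G S y -> vcomplete G v (component G S x).
Proof.
move=> vL; have cut' := full_cutset_sym cut.
exact: (incomplete_vcomplete Gfree cut' vL (cutset_x cut) (cutset_sep cut')).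
Qed.

Lemma incomplete_x_y_adj v : v \in incomplete_on G S y -> G u v.
Proof.
move=> vL; apply: (incomplete_complete Gfree cut u_incomplete).
have [vS _] := incomplete_onP _ _ _ _ vL; rewrite in_setD vS andbT.
apply/incomplete_onP => -[_ [z zx]].
by rewrite (incomplete_on_y_vcomplete vL).
Qed.

Lemma nonadjacent_common_neighbor v v' :
  v \in incomplete_on G S y ->
  v' \in incomplete_on G S y -> ~~ G v v' ->
  exists e, [/\ e \in component G S y, G v e & G v' e].
Proof.
move=> vL v'L vv'; have ntx := cutset_x cut; have nty := cutset_y cut.
have [vS _] := incomplete_onP _ _ _ _ vL; have [v'S _] := incomplete_onP _ _ _ _ v'L.
have xA := component_refl G S x.
have x_anti : vanticomplete G x (component G S y).
  exact: (component_anticomplete xS yS (cutset_sep cut)).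
have [e ey ve] := cutset_neighbor cut vS nty; exists e; split=> //.
by rewrite -(nonadjacent_agree (component_connected yS) x_anti Gfree
  (incomplete_on_y_vcomplete vL xA) (incomplete_on_y_vcomplete v'L xA) vv'
  (cutset_neighbor cut vS nty) (cutset_neighbor cut v'S nty)).
Qed.

Section SecondCutset.
Variables (e y' : V) (S' : {set V}).
Hypothesis e_y : e \in component G S y.
Hypothesis cut' : full_cutset (compl G) S' e y'.
Hypothesis disj : [disjoint [set e; u] :|: component G S x & S'].

Let e_x z : z \in component G S x -> compl G e z.
Proof.
move=> zx; rewrite compl_neq; last first.
  apply: contraNneq (cutset_sep cut) => ez.
  by rewrite -(component_eq zx) component_sym -ez.
by rewrite adj_sym (component_anticomplete xS yS (cutset_sep cut)).
Qed.

Lemma component_sub_second_component :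
  u |: component G S x \subset component (compl G) S' e.
Proof.
have notin z : z \in [set e; u] :|: component G S x -> z \notin S'.
  by move=> zW; rewrite (disjointFr disj zW).
have eS' : e \notin S' by rewrite notin // !inE eqxx.
have component_x z : z \in component G S x -> z \in component (compl G) S' e.
  move=> zx; apply: (component_step eS' _ (e_x zx) (component_refl _ _ _)).
  by rewrite notin // in_setU zx orbT.
apply/subsetP => z /setU1P[->|]; last exact: component_x.
have [uS [p px up]] := incomplete_onP _ _ _ _ u_incomplete.
apply: (component_step (p := p) _ _ _ (component_x _ px)).
- by rewrite notin // in_setU px orbT.
- by rewrite notin // !inE eqxx ?orbT.
rewrite adj_sym compl_neq //; apply: contraTneq uS => ->.
exact: component_notin px.
Qed.

(* A vertex of the new [L] is anticomplete in [G] to the component of [x], so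
   lies outside [S], and not adjacent to [u], so lies in a trivial component. *)
Lemma second_incomplete_clique :
  clique (compl G) (incomplete_on (compl G) S' y').
Proof.
have cutC := full_cutset_sym cut'.
set L' := incomplete_on _ _ _ => s t sL tL st; rewrite compl_neq //.
have anti w z : w \in L' -> z \in u |: component G S x -> compl G w z.
  move=> wL /(subsetP component_sub_second_component) ze.
  exact: (incomplete_vcomplete Gcfree cutC wL (cutset_x cut') (cutset_sep cutC)).
have notin_S w : w \in L' -> w \notin S.
  move=> wL; apply/negP => wS; have [z zx wz] := cutset_neighbor cut wS (cutset_x cut).
  by have /compl_nadj := anti w z wL (setU1r _ zx); rewrite wz.
apply: contraL (anti s u sL (setU11 _ _)) => Gst; apply: nadj_compl; rewrite adj_sym.
apply: (incomplete_vcomplete Gfree cut u_incomplete (z := s)) (component_refl _ _ _).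
  exact: edge_nontrivial (notin_S s sL) (notin_S t tL) Gst.
by apply: contraTN isT => /(setU1r u)/(anti s s sL); rewrite adj_irr.
Qed.

End SecondCutset.

Lemma nonclique_split_divide_compl v v' :
  v \in incomplete_on G S y ->
  v' \in incomplete_on G S y -> v != v' -> ~~ G v v' ->
  has_split_divide (compl G).
Proof.
move=> vL v'L vv'_neq vv'.
have [e [ey ve v'e]] := nonadjacent_common_neighbor vL v'L vv'.
pose W := [set e; u] :|: component G S x.
have W_anti w : w \in incomplete_on G S y -> G w e ->
    vanticomplete (compl G) w W.
  move=> wL we z; rewrite in_setU in_set2 -orbA => /or3P[/eqP->|/eqP->|zx];
    apply: nadj_compl => //.
    by rewrite adj_sym incomplete_x_y_adj.
  exact: incomplete_on_y_vcomplete.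
have vW : v \notin W.
  apply/negP => vW; have [vS _] := incomplete_onP _ _ _ _ vL.
  move: vW; rewrite in_setU in_set2 -orbA => /or3P[/eqP vE|/eqP vE|vx].
  - by move: ve; rewrite vE adj_irr.
  - by have := incomplete_x_y_adj vL; rewrite vE adj_irr.
  by rewrite (negPf (component_notin xS vx)) in vS.
have ex : compl G e x.
  rewrite compl_neq 1?adj_sym.
    apply: (component_anticomplete xS yS (cutset_sep cut)) => //.
    exact: component_refl.
  by apply: contraNneq (cutset_sep cut) => <-; rewrite component_sym.
have [|||S' [y' [cut' disj]]] :=
  full_cutset_exists _ _ ex _ vW (W_anti v vL ve) (W_anti v' v'L v'e).
- by rewrite !inE eqxx.
- by rewrite in_setU component_refl orbT.
- by rewrite compl_neq.
apply: (full_cutset_split_divide Gcfree (full_cutset_sym cut')).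
exact: second_incomplete_clique ey cut' disj.
Qed.

End TwoCutsets.

Lemma clique_or_nonedge (V : finType) (G : sgraph V) (K : {set V}) :
  clique G K \/ exists u v, [/\ u \in K, v \in K, u != v & ~~ G u v].
Proof.
have [/exists_inP[u uK /exists_inP[v vK /andP[uv nuv]]]|none] :=
    boolP [exists u in K, exists v in K, (u != v) && ~~ G u v].
  by right; exists u, v.
left=> u v uK vK uv; apply: contraNT none => nuv.
by apply/exists_inP; exists u => //; apply/exists_inP; exists v; rewrite ?uv.
Qed.

(** * Two disjoint anticomplete edges *)

Definition twoK2_free (V : finType) (G : sgraph V) : Prop := forall a b c d,
  G a b -> G c d -> ~~ G a c -> ~~ G a d -> ~~ G b c -> ~~ G b d -> False.

Lemma twoK2_free_or_split_divide (V : finType) (G : sgraph V) :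
  P5_house_C5_free G -> P5_house_C5_free (compl G) ->
  [\/ twoK2_free G, has_split_divide G | has_split_divide (compl G)].
Proof.
move=> Gfree Gcfree.
have [/existsP[[a b] /existsP[[c d] /and5P[ab cd ac ad /andP[bc bd]]]]|n2K2] := boolP
  [exists p : V * V, exists q : V * V, [&& G p.1 p.2, G q.1 q.2, ~~ G p.1 q.1,
     ~~ G p.1 q.2, ~~ G p.2 q.1 & ~~ G p.2 q.2]]; last first.
  apply: Or31 => a b c d ab cd ac ad bc bd; case/negP: n2K2.
  apply/existsP; exists (a, b); apply/existsP; exists (c, d).
  by rewrite /= ab cd ac ad bc.
have [|||||S [y [cut _]]] := @full_cutset_exists V G [set a; b] a b c d _ _ ab cd.
- by rewrite !inE eqxx.
- by rewrite !inE eqxx orbT.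
- by apply/set2P => -[cE|cE]; move: cd; rewrite cE; apply/negP.
- by move=> z /set2P[] ->; rewrite adj_sym.
- by move=> z /set2P[] ->; rewrite adj_sym.
have [clique_a|[u [_ [uL _ _ _]]]] :=
    clique_or_nonedge G (incomplete_on G S a).
  by apply: Or32; apply: full_cutset_split_divide cut clique_a.
have [clique_y|[v [v' [vL v'L vv'_neq vv']]]] :=
    clique_or_nonedge G (incomplete_on G S y).
  by apply: Or32; apply: full_cutset_split_divide (full_cutset_sym cut) clique_y.
by apply: Or33; apply: (nonclique_split_divide_compl Gfree Gcfree cut uL vL v'L).
Qed.

(** * The Foldes-Hammer theorem *)

Section FoldesHammer.
Variables (V : finType) (G : sgraph V).
Hypotheses (no_2K2 : twoK2_free G) (no_C4 : twoK2_free (compl G)).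
Hypothesis no_C5 : C5_free G.

Lemma twoK2_free_compl_no_C4 a b c d : G a b -> G b c -> G c d -> G d a ->
  ~~ G a c -> ~~ G b d -> a != c -> b != d -> False.
Proof.
move=> ab bc cd da ac bd ac_neq bd_neq.
have acC : compl G a c by rewrite compl_neq.
have bdC : compl G b d by rewrite compl_neq.
by apply: (no_C4 acC bdC); apply: nadj_compl; adj_done.
Qed.

Definition degree v := #|[set w | G v w]|.

Definition weight (K : {set V}) := \sum_(v in K) (degree v).+1.

(* Maximality of the weight makes the clique inclusion-maximal and prevents the
   exchange of a vertex for outside vertices of larger total degree. *)
Definition heaviest_clique (K : {set V}) : Prop :=
  clique G K /\ forall K', clique G K' -> weight K' <= weight K.

Lemma heaviest_clique_exists : exists K, heaviest_clique K.
Proof.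
pose cliqueb (K : {set V}) := [forall x in K, forall y in K, (x != y) ==> G x y].
have cliquebP K : reflect (clique G K) (cliqueb K).
  apply: (iffP forall_inP) => [cK x y xK yK xy|cK x xK].
    by have /forall_inP/(_ y yK) := cK x xK; rewrite xy.
  by apply/forall_inP => y yK; apply/implyP; apply: cK.
have clique0 : cliqueb set0 by apply/cliquebP => x y; rewrite inE.
case: (@arg_maxnP _ set0 cliqueb weight clique0) => K /cliquebP cK Kmax.
by exists K; split=> // K' /cliquebP; apply: Kmax.
Qed.

Lemma clique_setU1 (K : {set V}) x :
  clique G K -> vcomplete G x K -> clique G (x |: K).
Proof.
move=> cK xK y z /setU1P[->|yK] /setU1P[->|zK] yz; first by rewrite eqxx in yz.
- exact: xK.
- by rewrite adj_sym; apply: xK.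
exact: cK.
Qed.

Section Heaviest.
Variable K : {set V}.
Hypothesis K_heaviest : heaviest_clique K.

Let cK : clique G K := K_heaviest.1.
Let Kmax K' : clique G K' -> weight K' <= weight K := K_heaviest.2 K'.

Lemma heaviest_has_nonneighbor x : x \notin K -> has_nonneighbor G x K.
Proof.
move=> xK; have [/exists_inP //|none] := boolP [exists p in K, ~~ G x p].
have /Kmax : clique G (x |: K).
  apply: clique_setU1 => // q qK; apply: contraNT none => xq.
  by apply/exists_inP; exists q.
by rewrite /weight big_setU1 //= -[X in _ <= X]add0n leq_add2r.
Qed.

Lemma common_nonneighbor_unique x y p q : G x y -> p \in K -> q \in K ->
  ~~ G x p -> ~~ G y p -> ~~ G x q -> ~~ G y q -> p = q.
Proof.
move=> xy pK qK xp yp xq yq; have [//|pq] := eqVneq p q.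
by case: (no_2K2 xy (cK pK qK pq)).
Qed.

Lemma exchange_degree_leq x p : x \notin K -> p \in K -> clique G (x |: K :\ p) ->
  degree x <= degree p.
Proof.
move=> xK pK /Kmax; have xK' : x \notin K :\ p by rewrite !inE (negPf xK) andbF.
by rewrite /weight big_setU1 //= (big_setD1 p pK) /= leq_add2r.
Qed.

Lemma exchange_pair_degree_lt x y p : x \notin K -> y \notin K -> p \in K -> x != y ->
  clique G (y |: (x |: K :\ p)) -> degree x + degree y < degree p.
Proof.
move=> xK yK pK xy /Kmax; have xK' : x \notin K :\ p by rewrite !inE (negPf xK) andbF.
have yK' : y \notin x |: K :\ p by rewrite !inE (negPf yK) andbF orbF eq_sym.
rewrite /weight !big_setU1 //= (big_setD1 p pK) /= addnA leq_add2r.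
by rewrite addnS addSn ltnS addnC.
Qed.

Section NestedNonneighbors.
Variables (x y p : V).
Hypotheses (xK : x \notin K) (yK : y \notin K) (xy : G x y).
Hypotheses (pK : p \in K) (xp : ~~ G x p) (yp : ~~ G y p).
Hypothesis x_complete : vcomplete G x (K :\ p).

Let clique_x : clique G (x |: K :\ p).
Proof. by apply: clique_setU1 => // q r /setD1P[_ qK] /setD1P[_ rK]; apply: cK. Qed.

Lemma nested_nonneighbors_complete : vcomplete G y (K :\ p).
Proof.
move=> q /setD1P[qp qK]; apply/negPn/negP => yq.
have xq : G x q by apply: x_complete; rewrite in_setD1 qp.
have pq : G p q by apply: cK => //; rewrite eq_sym.
have [z] : exists2 z, G p z & ~~ G x z.
  apply/exists_inP; apply: contraLR (exchange_degree_leq xK pK clique_x) => none.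
  rewrite -ltnNge; apply: proper_card; apply/properP; split.
    apply/subsetP => z; rewrite !inE => pz; apply: contraNT none => xz.
    by apply/exists_inP; exists z.
  by exists y; rewrite !inE // adj_sym.
move=> pz xz; have yz : G y z.
  by apply/negPn/negP => yz; apply: (no_2K2 xy pz).
have [zq|zq] := boolP (G z q); last first.
  by apply: (no_C5 (a := x) (b := y) (c := z) (d := p) (e := q)); adj_done.
apply: (twoK2_free_compl_no_C4 (a := x) (b := y) (c := z) (d := q)) => //.
- by rewrite adj_sym.
- by apply: contraTneq pz => <-; rewrite adj_sym.
by apply: contraNneq yK => ->.
Qed.

End NestedNonneighbors.

Lemma nested_nonneighbors_nadj x y : x \notin K -> y \notin K ->
  {in K, forall p, ~~ G x p -> ~~ G y p} -> ~~ G x y.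
Proof.
move=> xK yK nested; apply/negP => xy.
have xy_neq : x != y by apply: contraTneq xy => ->; rewrite adj_irr.
have [p pK xp] := heaviest_has_nonneighbor xK; have yp := nested p pK xp.
have x_complete : vcomplete G x (K :\ p).
  move=> q /setD1P[qp qK]; apply: contraNT qp => xq; apply/eqP.
  by apply: (common_nonneighbor_unique xy qK pK xq _ xp yp); apply: nested.
have y_complete := nested_nonneighbors_complete xK yK xy pK xp yp x_complete.
have : degree x + degree y < degree p.
  apply: (exchange_pair_degree_lt xK yK pK xy_neq); apply: clique_setU1.
    by apply: clique_setU1 => // q r /setD1P[_ qK] /setD1P[_ rK]; apply: cK.
  by move=> q /setU1P[->|/y_complete //]; rewrite adj_sym.
rewrite ltnNge => /negP; apply; apply: leq_trans (leq_card_setU _ _).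
apply: subset_leq_card; apply/subsetP => z; rewrite !inE => pz.
by apply/negPn/negP; rewrite negb_or => /andP[xz yz]; apply: (no_2K2 xy pz).
Qed.

Lemma heaviest_compl_stable : stable G (~: K).
Proof.
move=> x y; rewrite !inE => xK yK; apply/negP => xy.
have [/exists_inP[p pK /andP[xp yp]]|none] :=
    boolP [exists p in K, ~~ G x p && G y p]; last first.
  have /negP[] // : ~~ G x y; apply: nested_nonneighbors_nadj => // p pK xp.
  by apply: contraNN none => yp; apply/exists_inP; exists p; rewrite ?xp.
have /negP[] : ~~ G y x; last by rewrite adj_sym.
apply: nested_nonneighbors_nadj => // q qK yq; apply/negP => xq.
apply: (twoK2_free_compl_no_C4 (a := x) (b := y) (c := p) (d := q)) => //.
- by apply: cK => //; apply: contraNneq xp => ->.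
- by rewrite adj_sym.
- by apply: contraNneq xK => ->.
by apply: contraNneq yK => ->.
Qed.

End Heaviest.

Lemma twoK2_C4_C5_free_split : split_graph G.
Proof.
have [K K_heaviest] := heaviest_clique_exists.
exists K, (~: K); split; first exact: setUCr.
- by rewrite -setI_eq0 setICr.
- exact: K_heaviest.1.
exact: heaviest_compl_stable K_heaviest.
Qed.

End FoldesHammer.

(** * Pentagons *)

Section Pentagon.
Variables (V : finType) (G : sgraph V).
Hypotheses (nP5 : P5_free G) (nhouse : house_free G).
Implicit Types (p : 'I_5 -> V) (i : 'I_5) (v w : V).

Definition pentagon p : Prop := {mono p : i j / C5 i j >-> G i j}.

Definition clone p i v : bool := [forall j, (j != i) ==> (G v (p j) == C5 i j)].

Lemma clone_self p i : pentagon p -> clone p i (p i).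
Proof. by move=> pM; apply/forallP => j; rewrite pM eqxx implybT. Qed.

Lemma clone_pentagon p i v :
  pentagon p -> clone p i v -> pentagon (fun j => if j == i then v else p j).
Proof.
move=> pM /forallP vi j k; have [->|ji] := eqVneq j i; have [->|ki] := eqVneq k i.
- by rewrite !adj_irr.
- by have := vi k; rewrite ki => /eqP.
- by have := vi j; rewrite ji adj_sym [RHS]adj_sym => /eqP.
exact: pM.
Qed.

Lemma pentagon_attachment p v : pentagon p ->
  [|| [forall j, G v (p j)], [forall j, ~~ G v (p j)] | [exists i, clone p i v]].
Proof.
move=> pM; pose path4 i j k l :=
  [&& C5 i j, C5 j k, C5 k l, ~~ C5 i k, ~~ C5 i l & ~~ C5 j l].
have no_pendant i j k l : path4 i j k l ->
    ~~ [&& G v (p i), ~~ G v (p j), ~~ G v (p k) & ~~ G v (p l)].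
  rewrite /path4 -!pM => /and5P[ij jk kl ik /andP[il jl]].
  by apply/negP => /and4P[vi vj vk vl]; apply: (nP5 vi ij jk kl).
have no_roof i j k l : path4 i j k l ->
    ~~ [&& G v (p i), ~~ G v (p j), G v (p k) & G v (p l)].
  rewrite /path4 -!pM => /and5P[ij jk kl ik /andP[il jl]].
  apply/negP => /and4P[vi vj vk vl].
  by apply: (nhouse (a := v) (b := p k) (c := p j) (d := p i) (e := p l)); adj_done.
have : [forall i, forall j, forall k, forall l, path4 i j k l ==>
    ~~ [&& G v (p i), ~~ G v (p j), ~~ G v (p k) & ~~ G v (p l)] &&
    ~~ [&& G v (p i), ~~ G v (p j), G v (p k) & G v (p l)]].
  do 4![apply/forallP => ?]; apply/implyP => ijkl.
  by rewrite no_pendant ?no_roof.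
rewrite {no_pendant no_roof} exists_ord5 /= /clone; do 4!rewrite !forall_ord5 /=.
by do 5!case: (G v _).
Qed.

Lemma clone_agree p i v w :
  pentagon p -> clone p i v -> ~~ clone p i w -> G w v = G w (p i).
Proof.
move=> pM vi wi; have p'M := clone_pentagon pM vi.
have := pentagon_attachment w p'M; have := pentagon_attachment w pM; move: wi.
rewrite !exists_ord5 /= /clone !forall_ord5 /=.
by move: i {vi p'M}; apply: ord5_ind => /=; case: (G w v); do 5!case: (G w (p _)).
Qed.

Lemma clones_homogeneous p i v : pentagon p -> clone p i v -> v != p i ->
  exists M, proper_homogeneous G M.
Proof.
move=> pM vi v_neq; exists [set w | clone p i w]; split.
- by move=> w y z; rewrite !inE => wi yi zi; rewrite !(clone_agree pM _ wi).
- by apply/card_gt1P; exists v, (p i); rewrite !inE vi clone_self.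
have [j ij] : exists j, C5 i j.
  by move: i {vi v_neq}; apply: ord5_ind; apply/existsP; rewrite exists_ord5.
apply/eqP => /setP/(_ (p j)); rewrite !inE => /forallP/(_ j).
by rewrite adj_irr ij; case: eqP ij => // ->; rewrite adj_irr.
Qed.

Lemma pentagon_homogeneous p v : pentagon p -> (forall i, v != p i) ->
  exists M, proper_homogeneous G M.
Proof.
move=> pM v_neq; have [/existsP[i vi]|v_not_clone] := boolP [exists i, clone p i v].
  exact: clones_homogeneous vi (v_neq i).
exists [set w | [exists i, clone p i w]]; split.
- move=> w y z; rewrite !inE => w_not_clone.
  suff agree u : [exists i, clone p i u] -> G w u = G w (p (ord5 0)).
    by move=> /agree-> /agree->.
  case/existsP=> i ui; rewrite (clone_agree pM ui); last first.
    by apply: contra w_not_clone => wi; apply/existsP; exists i.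
  have := pentagon_attachment w pM; rewrite (negPf w_not_clone) orbF.
  case/orP=> /forallP w_const; first by rewrite !w_const.
  by rewrite !(negPf (w_const _)).
- apply/card_gt1P; exists (p (ord5 0)), (p (ord5 1)); split.
  + by rewrite inE; apply/existsP; exists (ord5 0); apply: clone_self.
  + by rewrite inE; apply/existsP; exists (ord5 1); apply: clone_self.
  by rewrite (inj_eq (twin_free_inj twin_free_C5 pM)).
by apply: contraNneq v_not_clone => /setP/(_ v); rewrite !inE => ->.
Qed.

Lemma pentagon_isomorphic p :
  pentagon p -> (forall v, exists i, v = p i) -> isomorphic G C5.
Proof.
move=> pM p_onto; apply: isomorphic_sym; exists p => //.
apply: inj_card_bij; first exact: twin_free_inj twin_free_C5 pM.
rewrite -cardsT -[X in _ <= X]cardsT; apply: leq_trans (leq_imset_card p _).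
by apply/subset_leq_card/subsetP => v _; have [i ->] := p_onto v; apply: imset_f.
Qed.

End Pentagon.

(** * Free graphs are generated *)

Lemma full_hom_em (W V : finType) (K : sgraph W) (G : sgraph V) :
  full_hom K G \/ ~ full_hom K G.
Proof.
have [/existsP[f /forallP fM]|none] :=
    boolP [exists f : {ffun W -> V}, [forall i, forall j, G (f i) (f j) == K i j]].
  by left; exists f => i j; apply/eqP; have /forallP := fM i; apply.
right=> -[f fM]; case/negP: none; apply/existsP; exists [ffun i => f i].
by apply/forallP => i; apply/forallP => j; rewrite !ffunE fM.
Qed.

Lemma no_full_hom_P5_house_C5_free (V : finType) (G : sgraph V) :
  P5_antiP5_free G -> ~ full_hom C5 G -> P5_house_C5_free G.
Proof.
move=> /P5_antiP5_freeP[nP5 nantiP5] nC5; split.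
- exact: no_full_hom_P5_free.
- exact: no_full_hom_house_free.
exact: no_full_hom_C5_free.
Qed.

Lemma no_full_hom_C5_compl (V : finType) (G : sgraph V) :
  ~ full_hom C5 G -> ~ full_hom C5 (compl G).
Proof.
move=> nC5 /(full_hom_compl_right twin_free_C5) C5cG; apply: nC5.
exact: full_hom_trans (isomorphic_full_hom C5_self_complementary) C5cG.
Qed.

Lemma split_or_split_divide (V : finType) (G : sgraph V) :
  P5_antiP5_free G -> ~ full_hom C5 G ->
  [\/ split_graph G, has_split_divide G | has_split_divide (compl G)].
Proof.
move=> Gfree nC5; have patterns_free := no_full_hom_P5_house_C5_free Gfree nC5.
have compl_patterns_free : P5_house_C5_free (compl G).
  apply: no_full_hom_P5_house_C5_free; first exact/compl_P5_antiP5_free.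
  exact: no_full_hom_C5_compl.
have ccG_patterns_free : P5_house_C5_free (compl (compl G)).
  apply: no_full_hom_P5_house_C5_free; first by do 2!apply/compl_P5_antiP5_free.
  by do 2!apply: no_full_hom_C5_compl.
have [no_2K2|div|div] := twoK2_free_or_split_divide patterns_free compl_patterns_free.
- have [no_C4|div|div] :=
    twoK2_free_or_split_divide compl_patterns_free ccG_patterns_free.
  + by apply: Or31; apply: twoK2_C4_C5_free_split; case: patterns_free.
  + exact: Or33.
  by apply: Or32; apply: has_split_divide_complK.
- exact: Or32.
exact: Or33.
Qed.

Lemma P5_antiP5_free_generated (V : finType) (G : sgraph V) :
  P5_antiP5_free G -> generated G.
Proof.
have [n] := ubnP #|V|; elim: n V G => // n IHn V G; rewrite ltnS => Vn Gfree.
have IH (W : finType) (H : sgraph W) : #|W| < #|V| -> full_hom H G -> generated H.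
  move=> WV HG; apply: IHn (leq_trans WV Vn) _.
  exact: P5_antiP5_free_full_hom HG Gfree.
have IHc (W : finType) (H : sgraph W) :
    #|W| < #|V| -> full_hom H (compl G) -> generated (compl H).
  move=> WV HcG; apply: IHn (leq_trans WV Vn) _; apply/compl_P5_antiP5_free.
  by apply: P5_antiP5_free_full_hom HcG _; apply/compl_P5_antiP5_free.
have /P5_antiP5_freeP[nP5 nantiP5] := Gfree.
have [[p pM]|nC5] := full_hom_em C5 G.
  have [/existsP[v /forallP v_neq]|p_onto] := boolP [exists v, forall i, v != p i].
    have [M M_hom] := pentagon_homogeneous (no_full_hom_P5_free nP5)
      (no_full_hom_house_free nantiP5) pM v_neq.
    have [V0 W G0 x H iso G0G V0V HG WV] := homogeneous_substitution M_hom.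
    exact: gen_subst (IH _ _ V0V G0G) (IH _ _ WV HG) iso.
  apply/gen_pentagon/(pentagon_isomorphic pM) => v.
  move: p_onto; rewrite negb_exists => /forallP/(_ v).
  by rewrite negb_forall => /existsP[i /negPn/eqP->]; exists i.
have [G_split|/split_divide_unification|/split_divide_unification] :=
  split_or_split_divide Gfree nC5.
- exact: gen_split.
- case=> U H A B C L T a c comp iso hom1 lt1 hom2 lt2.
  by apply: gen_unif comp _ _ iso; apply: IH; rewrite ?card_sig.
case=> U H A B C L T a c comp iso hom1 lt1 hom2 lt2.
by apply: gen_counif comp _ _ iso; apply: IHc; rewrite ?card_sig.
Qed.

Theorem theorem5p2 (V : finType) (G : sgraph V) :
  P5_antiP5_free G <-> generated G.
Proof.
by split; [apply: P5_antiP5_free_generated | apply: generated_P5_antiP5_free].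
Qed.
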